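(* Let $f$ be a (real-valued) measurable function on a fixed cube $Q_0\subset\mathbb{R}^n$, $0<s<1/2$, and $1/2\le t<1-s$. Then there exist a (possibly empty) collection of subcubes $\{Q^v_j\}\subset\mathcal{D}(Q_0)$ ($v=1,2,\dots$), all different from $Q_0$, a family of collections of indices $\{I^v_2\}_v$ (for each $v$, $I^v_2$ is a set of indices $j$ of the cubes $Q^v_j$), and numbers $a^v_j$ such that: (i) for a.e. $x\in Q_0$, $$|f(x)-m_f(t,Q_0)|\le 4M^{\sharp}_{0,s,Q_0}f(x)+\sum_{v=1}^{\infty}\sum_{j\in I^v_2}a^v_j\,\mathbf{1}_{Q^v_j}(x),$$ where $$a^v_j\le 10n\inf_{y\in Q^v_j}M^{\sharp}_{0,s,\widehat{Q^v_j}}f(y)+2\inf_{y\in Q^v_j}M^{\sharp}_{0,s,Q^v_j}f(y)\le(10n+2)\inf_{y\in Q^v_j}M^{\sharp}_{0,s,\widehat{Q^v_j}}f(y);$$ (ii) for fixed $v$, the cubes $\{Q^v_j\}_j$ are nonoverlapping; (iii) if $\Omega^v=\bigcup_jQ^v_j$, then $\Omega^{v+1}\subset\Omega^v$; and (iv) for all $v$ and $j$, $|\Omega^{v+1}\cap Q^v_j|\le\frac{s}{1-t}\,|Q^v_j|$.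
   Context: All cubes have sides parallel to the axes. For a cube $Q\subset\mathbb{R}^n$ and $0<t<1$, the (maximal) median of $f$ over $Q$ with parameter $t$ is $$m_f(t,Q)=\sup\{M:|\{y\in Q:f(y)<M\}|\le t|Q|\}.$$ For a cube $Q_0$ and $0<s\le1/2$, the local sharp maximal function restricted to $Q_0$ of a measurable function $f$ at $x\in Q_0$ is $$M^{\sharp}_{0,s,Q_0}f(x)=\sup_{x\in Q,\,Q\subset Q_0}\ \inf_c\ \inf\{\alpha\ge0:|\{y\in Q:|f(y)-c|>\alpha\}|<s|Q|\},$$ the supremum being over cubes $Q$. $\mathcal{D}(Q_0)$ denotes the family of dyadic subcubes relative to $Q_0$, i.e., those formed by repeated dyadic subdivision of $Q_0$ into $2^n$ congruent subcubes. For $Q\in\mathcal{D}(Q_0)$, $Q\ne Q_0$, $\widehat{Q}\in\mathcal{D}(Q_0)$ denotes its dyadic parent. Nonoverlapping means having disjoint interiors. $\mathbf{1}_E$ is the indicator function of $E$. *)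

(* Defs.v *)
From HB Require Import structures.
From mathcomp Require Import all_boot all_order all_algebra.
From mathcomp Require Import all_classical all_reals all_analysis.

Set Implicit Arguments.
Unset Strict Implicit.
Unset Printing Implicit Defensive.

Import Order.TTheory GRing.Theory Num.Theory.
Import numFieldNormedType.Exports.

Local Open Scope classical_set_scope.
Local Open Scope ring_scope.

(* Lebesgue measure on R^n ('rV[R]_n): the outer measure is the infimum of the
   total volumes of the countable families of closed boxes covering a set, and
   the Lebesgue measurable sets are those satisfying Caratheodory's criterion. *)
Section lebesgue_measure_rV.
Context {R : realType} {n : nat}.
Implicit Types (A : set 'rV[R]_n) (b : 'rV[R]_n * 'rV[R]_n).

(* The box with corners b.1 and b.2; it is empty, and its volume is 0, when
   b.2 0 i < b.1 0 i for some i. *)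
Definition box b : set 'rV[R]_n :=
  [set x | forall i, b.1 ord0 i <= x ord0 i <= b.2 ord0 i].

Definition box_volume b : \bar R :=
  (\prod_(i < n) Num.max 0 (b.2 ord0 i - b.1 ord0 i))%:E.

Definition box_cover A : set (set ('rV[R]_n * 'rV[R]_n)) :=
  [set S | countable S /\ A `<=` \bigcup_(b in S) box b].

Definition lebesgue_rV A : \bar R :=
  ereal_inf [set \esum_(b in S) box_volume b | S in box_cover A].

Lemma box_volume_ge0 b : (0 <= box_volume b)%E.
Proof. by rewrite lee_fin prodr_ge0// => i _; rewrite le_max lexx. Qed.

Lemma lebesgue_rV_ge0 A : (0 <= lebesgue_rV A)%E.
Proof.
apply: le_ereal_inf_tmp => _ [S _ <-].
by apply: esum_ge0 => b _; exact: box_volume_ge0.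
Qed.

Lemma lebesgue_rV0 : lebesgue_rV set0 = 0%E.
Proof.
apply/eqP; rewrite eq_le lebesgue_rV_ge0 andbT.
apply: ereal_inf_lbound; exists set0; last exact: esum_set0.
by split; [exact: countable0|exact: sub0set].
Qed.

Lemma le_lebesgue_rV : {homo lebesgue_rV : A B / A `<=` B >-> (A <= B)%E}.
Proof.
move=> A B AB; apply: ereal_inf_le_tmp => _ [S [cS BS] <-].
by exists S => //; split => //; exact: subset_trans BS.
Qed.

Lemma lebesgue_rV_sigma_subadditive : sigma_subadditive lebesgue_rV.
Proof.
move=> A; have [[i ioo]|] := pselect (exists i, lebesgue_rV (A i) = +oo%E).
  rewrite (eseries_pinfty _ _ ioo) ?leey// => k _.
  by rewrite -ltNye (lt_le_trans _ (lebesgue_rV_ge0 _)).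
rewrite -forallNE => Aoo.
apply/lee_addgt0Pr => _/posnumP[e].
rewrite (le_trans _ (epsilon_trick _ _ _))//; last first.
  by move=> k; exact: lebesgue_rV_ge0.
have /choice[S SP] : forall k, exists S, box_cover (A k) S /\
    (\esum_(b in S) box_volume b <=
      lebesgue_rV (A k) + (e%:num / (2 ^ k.+1)%:R)%:E)%E.
  move=> k; have ek : 0 < e%:num / (2 ^ k.+1)%:R :> R by [].
  have Afin : lebesgue_rV (A k) \is a fin_num.
    by rewrite ge0_fin_numE ?lebesgue_rV_ge0// ltey; apply/eqP/Aoo.
  have [_ [S AS <-] /ltW SA] := lb_ereal_inf_adherent ek Afin.
  by exists S.
apply: (@le_trans _ _ (\esum_(b in \bigcup_k S k) box_volume b)).
  apply: ereal_inf_lbound; exists (\bigcup_k S k) => //; split.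
    by apply: bigcup_countable => // k _; exact: (SP k).1.1.
  move=> x [k _ /((SP k).1.2)[b Sb bx]].
  by exists b => //; exists k.
rewrite seqDU_bigcup_eq nneseries_sum_bigcup//; last exact: box_volume_ge0.
apply: lee_nneseries => [k _ _|k _].
  by apply: esum_ge0 => b _; exact: box_volume_ge0.
apply: le_trans (SP k).2.
rewrite [leRHS](esumID (seqDU S k)); last by move=> b _; exact: box_volume_ge0.
rewrite (_ : S k `&` seqDU S k = seqDU S k).
  by rewrite leeDl// esum_ge0// => b _; exact: box_volume_ge0.
by apply/setIidr; exact: subset_seqDU.
Qed.

HB.instance Definition _ := isOuterMeasure.Build R 'rV[R]_n lebesgue_rV
  lebesgue_rV0 lebesgue_rV_ge0 le_lebesgue_rV lebesgue_rV_sigma_subadditive.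

Definition lebesgue_measurable_fun (D : set 'rV[R]_n) (f : 'rV[R]_n -> R) :=
  measurable_fun (D : set (caratheodory_type lebesgue_rV))
                 (f : caratheodory_type lebesgue_rV -> R).

Definition lebesgue_ae (P : 'rV[R]_n -> Prop) :=
  {ae (lebesgue_rV : set (caratheodory_type lebesgue_rV) -> \bar R),
    forall x, P x}.

End lebesgue_measure_rV.

Section cubes.
Context {R : realType} {n : nat}.

(* Closed nondegenerate cubes with sides parallel to the axes; [corner Q] is
   the vertex with the smallest coordinates. *)
Record cube := Cube {
  corner : 'rV[R]_n;
  side : R;
  side_gt0 : 0 < side }.

HB.instance Definition _ := gen_eqMixin cube.
HB.instance Definition _ := gen_choiceMixin cube.

Definition cube_set (Q : cube) : set 'rV[R]_n :=
  [set x | forall i,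
    corner Q ord0 i <= x ord0 i <= corner Q ord0 i + side Q].

Definition nonoverlapping (Q Q' : cube) : Prop :=
  interior (cube_set Q) `&` interior (cube_set Q') = set0.

(* Q is one of the 2^n congruent cubes into which P is subdivided. *)
Definition dyadic_child (P Q : cube) : Prop :=
  side Q = side P / 2 /\
  exists e : 'I_n -> bool, forall i,
    corner Q ord0 i = corner P ord0 i + (if e i then side P / 2 else 0).

Inductive dyadic (Q0 : cube) : cube -> Prop :=
| dyadic_root : dyadic Q0 Q0
| dyadic_step P Q : dyadic Q0 P -> dyadic_child P Q -> dyadic Q0 Q.

(* The cube of D(Q0) having Q as a child; it is unique for Q in D(Q0) distinct
   from Q0 (and Q itself is a default value otherwise). *)
Definition dyadic_parent (Q0 Q : cube) : cube :=
  xget Q [set P | dyadic Q0 P /\ dyadic_child P Q].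

End cubes.

Arguments cube : clear implicits.
Coercion cube_set : cube >-> set.

Section median_sharp.
Context {R : realType} {n : nat}.
Implicit Types (f : 'rV[R]_n -> R) (Q : cube R n).

Definition median f (t : R) Q : R :=
  sup [set M : R | (lebesgue_rV (Q `&` [set y | (f y < M)%R])
                    <= t%:E * lebesgue_rV Q)%E].

Definition local_oscillation (s : R) f Q : \bar R :=
  ereal_inf [set ereal_inf [set a%:E | a in [set a : R | 0 <= a /\
      (lebesgue_rV (Q `&` [set y | (a < `|f y - c|)%R])
         < s%:E * lebesgue_rV Q)%E]] | c in [set: R]].

Definition local_sharp (s : R) Q0 f (x : 'rV[R]_n) : \bar R :=
  ereal_sup [set local_oscillation s f Q | Q in
    [set Q : cube R n | cube_set Q x /\ Q `<=` Q0]].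

End median_sharp.

(* Main.v *)
From HB Require Import structures.
Require Import Defs.
From mathcomp Require Import all_boot all_order all_algebra.
From mathcomp Require Import all_classical all_reals all_analysis.
From mathcomp Require Import zify ring lra.
Import Order.TTheory GRing.Theory Num.Theory.
Import numFieldNormedType.Exports.
Local Open Scope classical_set_scope.
Local Open Scope ring_scope.
Set Implicit Arguments.
Unset Strict Implicit.
Unset Printing Implicit Defensive.

(** Write m(Q) for the median of f over Q with parameter t, and osc(Q) for its
    local oscillation, so that osc(Q) is at most the local sharp maximal
    function restricted to any cube containing Q, at any point of Q.

    Fix a cube S and let E be the set where |f - m(S)| > 2 osc(S). A constant
    that nearly realizes osc(S) is within osc(S) of m(S), because s <= t and
    s <= 1 - t ([median_close]); hence |S n E| <= s |S|
    ([lebesgue_median_deviation]). Call a proper dyadic subcube Q of S dense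
    when |Q n E| >= (1 - t) |Q|, and select the maximal dense cubes. They are
    nonoverlapping, so their total measure is at most
    |S n E| / (1 - t) <= s / (1 - t) |S| ([lebesgue_stopping_cubes]). Almost
    everywhere on the rest of S, |f - m(S)| <= 2 osc(S), since a set that is
    sparse in every dyadic cube is null ([lebesgue_sparse_null]). The dyadic
    parent P of a selected cube is S or is not dense, and then
    |m(P) - m(S)| <= 2 osc(S) by [median_close] again.

    Selecting again inside each selected cube, and so on, gives the families
    indexed by v. Since s / (1 - t) < 1, almost every x lies in finitely many
    generations only, and along the selected cubes containing x the estimates
    above telescope to
      |f(x) - m(Q0)| <= 2 osc(Q0) + sum of (|m(Q) - m(P)| + 2 osc(Q)),
    the sum being over the selected cubes Q that contain x, with P the parent
    of Q ([level_median]). The summands are the coefficients a, and all indices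
    belong to I2.

    What remains is |m(Q) - m(P)| <= 10 n M, where M is the sharp maximal
    function restricted to P at a point of Q ([median_parent_le]). As s may be
    close to 1/2, the cubes Q and P cannot be compared directly. Instead, let Q
    grow to P through finely spaced nested cubes; all of them have oscillation
    at most M. For each of them f is within M of some constant on more than
    half of the cube, and the constants of two consecutive cubes differ by at
    most 2 M. As long as the volume does not double, no three of these
    constants are pairwise more than 2 M apart, because the three sets would be
    disjoint and together too large for the biggest cube. Hence the constant
    moves by at most 6 M while the volume doubles ([slow_two_cluster]); the
    volume doubles n times between Q and P, and with the n - 1 transitions and
    the two end points the total is 6 n M + 2 (n - 1) M + 2 M = 8 n M.

    Cubes may be assumed to have positive measure: by homogeneity,
    |Q| = (side Q / side Q')^n |Q'| ([lebesgue_cube_scale]), either all cubes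
    are null or none is, and over a null cube the oscillation is infinite, so
    that the estimate is void. *)

(** * Countable sums and outer measures *)

Section countable_sums.
Context {R : realType}.
Local Open Scope ereal_scope.

Lemma countable_indexing (T : pointedType) (A : set T) : countable A ->
  exists (D : set nat) (g : nat -> T), set_bij D A g.
Proof.
move=> /countable_bijP[B]; rewrite card_eq_sym => /ppcard_eqP[f].
by exists B, f; exact: bij.
Qed.

Lemma esum_nneseries (T : pointedType) (A : set T) (D : set nat) (g : nat -> T)
    (a : T -> \bar R) : set_bij D A g -> (forall i, 0 <= a i) ->
  \esum_(i in A) a i = \sum_(0 <= k <oo) (if k \in D then a (g k) else 0).
Proof.
move=> Dg a0; rewrite (reindex_esum D A g a Dg) esum_mkcond nneseries_esumT// => k.
by case: ifP.
Qed.

Lemma le_esum_set (T : choiceType) (A B : set T) (a : T -> \bar R) :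
  A `<=` B -> (forall i, 0 <= a i) ->
  \esum_(i in A) a i <= \esum_(i in B) a i.
Proof.
move=> AB a0; rewrite esum_mkcond [leRHS]esum_mkcond.
apply: le_esum => i _; case: ifPn => [|_]; last by case: ifP.
by move=> /set_mem/AB/mem_set ->.
Qed.

Lemma le_esum_image (T T' : pointedType) (A : set T) (h : T -> T')
    (a : T' -> \bar R) : (forall i, 0 <= a i) ->
  \esum_(j in h @` A) a j <= \esum_(i in A) a (h i).
Proof.
move=> a0.
have [g gP] : {g : T' -> T & forall y, (h @` A) y -> A (g y) /\ h (g y) = y}.
  apply: (@choice _ _ (fun y x => (h @` A) y -> A x /\ h x = y)) => y.
  have [[x Ax hx]|nA] := pselect ((h @` A) y); first by exists x.
  by exists point => /nA.
have hg : set_bij (g @` (h @` A)) (h @` A) h.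
  split.
  - by move=> _ [y hy <-] /=; rewrite (gP _ hy).2.
  - move=> _ _ /set_mem[y hy <-] /set_mem[z hz <-].
    by rewrite (gP _ hy).2 (gP _ hz).2 => ->.
  - by move=> y hy; exists (g y); [exists y|exact: (gP _ hy).2].
rewrite (reindex_esum _ _ _ a hg); apply: le_esum_set => // _ [y hy <-].
exact: (gP _ hy).1.
Qed.

Lemma esumZl (T : pointedType) (A : set T) (c : R) (a : T -> \bar R) :
  countable A -> (forall i, 0 <= a i) -> (0 <= c)%R ->
  \esum_(i in A) (c%:E * a i) = c%:E * \esum_(i in A) a i.
Proof.
move=> /countable_indexing[D [g Dg]] a0 c0.
rewrite !(esum_nneseries Dg)//; last by move=> i; rewrite mule_ge0.
rewrite -nneseriesZl; last by move=> i _; case: ifP.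
by apply: eq_eseriesr => k _; case: ifP => //; rewrite mule0.
Qed.

Lemma outer_measure_esum (U : Type) (T : pointedType)
    (mu : {outer_measure set U -> \bar R}) (A : set T) (X : T -> set U) :
  countable A -> mu (\bigcup_(i in A) X i) <= \esum_(i in A) mu (X i).
Proof.
move=> /countable_indexing[D [g Dg]]; rewrite (esum_nneseries Dg); last first.
  by move=> i; exact: outer_measure_ge0.
pose Y k := if k \in D then X (g k) else set0.
apply: (@le_trans _ _ (mu (\bigcup_k Y k))).
  apply: le_outer_measure => x [i Ai Xx].
  have [_ _ /(_ _ Ai)[k Dk gk]] := Dg.
  by exists k => //; rewrite /Y mem_set// gk.
apply: le_trans (outer_measure_sigma_subadditive mu Y) _.
apply: lee_nneseries => [k _ _|k _]; first exact: outer_measure_ge0.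
rewrite /Y; by case: ifP => // _; rewrite outer_measure0.
Qed.

(** An outer measure is superadditive on disjoint Caratheodory measurable sets
    even when they are cut by an arbitrary set [Y]. *)
Lemma caratheodory_esum_le (U : Type) (T : pointedType)
    (mu : {outer_measure set U -> \bar R}) (A : set T) (X : T -> set U)
    (Y : set U) :
  countable A -> (forall i, A i -> mu.-caratheodory (X i)) -> trivIset A X ->
  \esum_(i in A) mu (Y `&` X i) <= mu Y.
Proof.
move=> /countable_indexing[D [g Dg]] mX tX; rewrite (esum_nneseries Dg); last first.
  by move=> i; exact: outer_measure_ge0.
pose Z k := if k \in D then X (g k) else set0.
have [DA injg _] := Dg.
have mZ k : mu.-caratheodory (Z k).
  rewrite /Z; case: ifPn => [/set_mem Dk|_]; last first.
    exact: caratheodory_measurable_set0.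
  exact/mX/DA.
have tZ : trivIset setT Z.
  move=> i j _ _ [x []]; rewrite /Z; case: ifPn => // Di Xi; case: ifPn => // Dj Xj.
  apply: injg => //; apply: tX; [exact/DA/set_mem|exact/DA/set_mem|].
  by exists x.
apply: le_trans (caratheodory_lime_le mZ tZ Y).
apply: (@le_trans _ _ (\sum_(0 <= k <oo) mu (Y `&` Z k))); last first.
  by rewrite leeDl// outer_measure_ge0.
apply: lee_nneseries => [k _ _|k _].
  by case: ifP => // _; exact: outer_measure_ge0.
by rewrite /Z; case: ifP => // _; exact: outer_measure_ge0.
Qed.

End countable_sums.

(** * Lebesgue measure of cubes *)

Section lebesgue_cubes.
Context {R : realType} {n : nat}.
Local Notation mu := (@lebesgue_rV R n).
Implicit Types (A : set 'rV[R]_n) (Q : cube R n).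

(* Countable families of cubes are enumerated by functions from nat, which need
   a default cube. *)
HB.instance Definition _ :=
  isPointed.Build (cube R n) (Cube 0 (ltr01 : 0 < 1 :> R)).

(** The form in which finite additivity and monotone continuity of measures
    apply to [lebesgue_rV]. *)

Definition lebesgue_outer : {outer_measure set 'rV[R]_n -> \bar R} := mu.
Definition lebesgue_caratheodory :
    {measure set (caratheodory_type lebesgue_outer) -> \bar R} :=
  lebesgue_outer : set (caratheodory_type lebesgue_outer) -> \bar R.

Lemma lebesgue_box_le (b : 'rV[R]_n * 'rV[R]_n) :
  (mu (box b) <= box_volume b)%E.
Proof.
rewrite -(esum_set1 (t:=b) (a:=box_volume)) ?box_volume_ge0//.
apply: ereal_inf_lbound; exists [set b] => //; split; first exact: countable1.
by move=> x bx; exists b.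
Qed.

(** The hyperplane x_i = c cuts every box of a cover into two boxes whose
    volumes add up. Leaving [A] undetermined on the hyperplane covers open and
    closed half-spaces at once. *)
Lemma lebesgue_halfspace_caratheodory (i : 'I_n) (c : R) A :
    (forall x : 'rV[R]_n, x ord0 i < c -> A x) ->
    (forall x : 'rV[R]_n, A x -> x ord0 i <= c) ->
  mu.-caratheodory A.
Proof.
move=> ltA Ale; apply: (@le_caratheodory_measurable _ _ mu) => X.
apply: le_ereal_inf_tmp => _ [S [cS XS] <-].
pose lo (b : 'rV[R]_n * 'rV[R]_n) : 'rV[R]_n * 'rV[R]_n :=
  (b.1, \row_j (if j == i then Num.min (b.2 ord0 j) c else b.2 ord0 j)).
pose hi (b : 'rV[R]_n * 'rV[R]_n) : 'rV[R]_n * 'rV[R]_n :=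
  (\row_j (if j == i then Num.max (b.1 ord0 j) c else b.1 ord0 j), b.2).
have split_volume b : box_volume b = (box_volume (lo b) + box_volume (hi b))%E.
  rewrite /box_volume -EFinD; congr EFin.
  rewrite [LHS](bigD1 i)//= [X in _ = X + _](bigD1 i)//=.
  rewrite [X in _ = _ + X](bigD1 i)//= !mxE eqxx.
  rewrite [X in _ = _ * X + _](_ : _ =
      \prod_(j < n | j != i) Num.max 0 (b.2 ord0 j - b.1 ord0 j)); last first.
    by apply: eq_bigr => j ji; rewrite !mxE (negbTE ji).
  rewrite [X in _ = _ + _ * X](_ : _ =
      \prod_(j < n | j != i) Num.max 0 (b.2 ord0 j - b.1 ord0 j)); last first.
    by apply: eq_bigr => j ji; rewrite !mxE (negbTE ji).
  rewrite -mulrDl; congr (_ * _).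
  rewrite /Num.max /Num.min.
  by case: (ltP (b.2 ord0 i) c) => ?; case: (ltP (b.1 ord0 i) c) => ?;
    do !case: ltP => ?; lra.
apply: (@le_trans _ _ (\esum_(b in lo @` S) box_volume b +
                       \esum_(b in hi @` S) box_volume b)%E).
  apply: leeD; apply: ereal_inf_lbound; eexists=> //; split => //.
  - exact: sub_countable (card_image_le _ _) cS.
  - move=> x [Xx Ax]; have [b Sb bx] := XS _ Xx.
    exists (lo b); first by exists b.
    move=> j; rewrite /= !mxE; have /andP[-> le2] := bx j.
    case: eqP => [->|]//=; rewrite le_min Ale// andbT.
    by have /andP[] := bx i.
  - exact: sub_countable (card_image_le _ _) cS.
  - move=> x [Xx Ax]; have [b Sb bx] := XS _ Xx.
    exists (hi b); first by exists b.
    move=> j; rewrite /= !mxE; have /andP[le1 ->] := bx j; rewrite andbT.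
    case: eqP => [->|]//=; rewrite ge_max; apply/andP; split.
      by have /andP[] := bx i.
    by rewrite leNgt; apply/negP => /ltA.
apply: le_trans.
  by apply: leeD; apply: le_esum_image => b; exact: box_volume_ge0.
rewrite -esumD; try by move=> b _; exact: box_volume_ge0.
by apply: le_esum => b _; rewrite (split_volume b).
Qed.

(** A homothety maps covers by boxes to covers by boxes. *)
Lemma lebesgue_affine_le (h : R) (v : 'rV[R]_n) A : 0 < h ->
  (mu ((fun x => h *: x + v)%R @` A) <= (h ^+ n)%:E * mu A)%E.
Proof.
move=> h0; have hn0 : 0 < h ^+ n by rewrite exprn_gt0.
rewrite -lee_pdivrMl//; apply: le_ereal_inf_tmp => _ [S [cS AS] <-].
rewrite lee_pdivrMl//.
pose phi (x : 'rV[R]_n) := h *: x + v.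
pose psi (b : 'rV[R]_n * 'rV[R]_n) := (phi b.1, phi b.2).
apply: (@le_trans _ _ (\esum_(b in psi @` S) box_volume b)%E).
  apply: ereal_inf_lbound; eexists => //; split.
    exact: sub_countable (card_image_le _ _) cS.
  move=> _ [x Ax <-]; have [b Sb bx] := AS _ Ax.
  exists (psi b); first by exists b.
  move=> i; rewrite /= !mxE; have := bx i.
  by rewrite !lerD2r !ler_pM2l.
apply: le_trans; first by apply: le_esum_image => b; exact: box_volume_ge0.
rewrite -esumZl//; last exact: ltW; last by move=> b; exact: box_volume_ge0.
apply: le_esum => b _; rewrite /box_volume -EFinM lee_fin.
rewrite -[X in _ ^+ X](card_ord n) -prodr_const -big_split/=.
rewrite ler_prod// => i _; rewrite le_max lexx/= !mxE.
by rewrite (maxr_pMr _ _ (ltW h0)) mulr0 mulrBr opprD addrACA subrr addr0.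
Qed.

Lemma cube_affine Q Q' :
  cube_set Q = (fun x => (side Q / side Q') *: x +
    (corner Q - (side Q / side Q') *: corner Q')) @` cube_set Q'.
Proof.
have Q0 := side_gt0 Q; have Q'0 := side_gt0 Q'.
apply/seteqP; split => [x Qx|_ [x Q'x <-] i].
  exists ((side Q' / side Q) *: (x - corner Q) + corner Q') => [i|].
    have := Qx i; rewrite !mxE => /andP[l u].
    have r0 : 0 < side Q' / side Q by rewrite divr_gt0.
    apply/andP; split; first by rewrite lerDr (mulr_ge0 (ltW r0))// subr_ge0.
    rewrite addrC lerD2l -[leRHS](divfK (lt0r_neq0 Q0)).
    by rewrite ler_pM2l// lerBlDl.
  apply/rowP => i; rewrite !mxE; field.
  by rewrite !lt0r_neq0.
have := Q'x i; rewrite !mxE => /andP[l u].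
have r0 : 0 < side Q / side Q' by rewrite divr_gt0.
rewrite addrCA lerDl -mulrBr (mulr_ge0 (ltW r0)) ?subr_ge0//= lerD2l.
rewrite -[leRHS](divfK (lt0r_neq0 Q'0)) ler_pM2l//.
by rewrite lerBlDl.
Qed.

Lemma lebesgue_cube_le Q : (mu Q <= (side Q ^+ n)%:E)%E.
Proof.
have Q0 := side_gt0 Q.
pose b := (corner Q, \row_i (corner Q ord0 i + side Q)).
have -> : cube_set Q = box b.
  by apply/seteqP; split=> x + i => /(_ i); rewrite /= mxE.
apply: (le_trans (lebesgue_box_le b)).
rewrite lee_fin -[X in _ ^+ X](card_ord n) -prodr_const ler_prod// => i _.
rewrite le_max lexx/= mxE addrAC subrr add0r.
by rewrite ge_max lexx ltW.
Qed.

Lemma lebesgue_cube_fin Q : mu Q \is a fin_num.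
Proof.
rewrite ge0_fin_numE; last exact: lebesgue_rV_ge0.
exact: le_lt_trans (lebesgue_cube_le Q) (ltry _).
Qed.

(** Apply [lebesgue_affine_le] to the homothety from [Q'] to [Q] and to its
    inverse. *)
Lemma lebesgue_cube_scale Q Q' :
  mu Q = (((side Q / side Q') ^+ n)%:E * mu Q')%E.
Proof.
have Q0 := side_gt0 Q; have Q'0 := side_gt0 Q'.
apply/eqP; rewrite eq_le; apply/andP; split.
  by rewrite {1}(cube_affine Q Q') lebesgue_affine_le// divr_gt0.
rewrite -lee_pdivlMl ?exprn_gt0 ?divr_gt0//.
rewrite -exprVn invf_div {1}(cube_affine Q' Q).
by rewrite lebesgue_affine_le// divr_gt0.
Qed.

Definition open_cube Q : set 'rV[R]_n :=
  [set x | forall i,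
    corner Q ord0 i < x ord0 i < corner Q ord0 i + side Q].

Lemma interior_cube Q : interior (cube_set Q) = open_cube Q.
Proof.
apply/seteqP; split => x.
  move=> /nbhs_ballP[e /= e0 xeQ] i.
  have e20 : 0 < e / 2 by rewrite divr_gt0.
  have ball_shift d : `|d| < e -> cube_set Q (x + const_mx d).
    move=> de; apply: xeQ; split => // k j.
    by rewrite /ball/= !mxE opprD addrA subrr add0r normrN.
  have e2 : `|e / 2| < e by rewrite gtr0_norm//; lra.
  have /(_ i) := ball_shift _ e2; have := ball_shift (- (e / 2)).
  rewrite normrN => /(_ e2) /(_ i); rewrite !mxE => /andP[? _] /andP[_ ?].
  by apply/andP; split; lra.
move=> Qx; rewrite /interior.
have near_i i : \forall y \near (x : 'rV[R]_n),
    corner Q ord0 i <= (y : 'rV[R]_n) ord0 i <= corner Q ord0 i + side Q.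
  have /andP[lo hi] := Qx i.
  have cx := @coord_continuous R 1 n ord0 i x.
  near=> y; apply/andP; split; apply: ltW; near: y.
    exact: (cvgr_gt _ cx).
  exact: (cvgr_lt _ cx).
exact: filter_forall near_i.
Unshelve. all: by end_near. Qed.

Lemma open_cube_caratheodory Q : mu.-caratheodory (open_cube Q).
Proof.
have -> : open_cube Q = \bigcap_(i in [set: 'I_n])
    ([set x : 'rV[R]_n | x ord0 i < corner Q ord0 i + side Q] `\`
     [set x : 'rV[R]_n | x ord0 i <= corner Q ord0 i]).
  apply/seteqP; split => x Qx i; have := Qx i.
    by move=> /andP[lo hi] _; split => //=; apply/negP; rewrite -ltNge.
  by move=> /(_ I)[/= -> /negP]; rewrite -ltNge => ->.
apply: (@fin_bigcap_measurable _ (caratheodory_type mu)) => [|i _].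
  exact: finite_finset.
apply: measurableD.
  by apply: (@lebesgue_halfspace_caratheodory i (corner Q ord0 i + side Q)) =>
    x //= /ltW.
by apply: (@lebesgue_halfspace_caratheodory i (corner Q ord0 i)) => x //= /ltW.
Qed.

Lemma cube_caratheodory Q : mu.-caratheodory (cube_set Q).
Proof.
have -> : cube_set Q = \bigcap_(i in [set: 'I_n])
    ([set x : 'rV[R]_n | x ord0 i <= corner Q ord0 i + side Q] `\`
     [set x : 'rV[R]_n | x ord0 i < corner Q ord0 i]).
  apply/seteqP; split => x Qx i; have := Qx i.
    by move=> /andP[lo hi] _; split => //=; apply/negP; rewrite -leNgt.
  by move=> /(_ I)[/= -> /negP]; rewrite -leNgt => ->.
apply: (@fin_bigcap_measurable _ (caratheodory_type mu)) => [|i _].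
  exact: finite_finset.
apply: measurableD.
  by apply: (@lebesgue_halfspace_caratheodory i (corner Q ord0 i + side Q)) =>
    x //= /ltW.
by apply: (@lebesgue_halfspace_caratheodory i (corner Q ord0 i)) => x //= /ltW.
Qed.

(** The boundary lies in the faces, which are boxes of volume 0. *)
Lemma lebesgue_cube_boundary Q : mu (cube_set Q `\` open_cube Q) = 0%E.
Proof.
pose face (i : 'I_n) c := cube_set Q `&` [set x : 'rV[R]_n | x ord0 i = c].
have face0 i c : mu (face i c) = 0%E.
  apply/eqP; rewrite eq_le outer_measure_ge0 andbT.
  pose b := (\row_j (if j == i then c else corner Q ord0 j),
             \row_j (if j == i then c else corner Q ord0 j + side Q)).
  apply: (@le_trans _ _ (mu (box b))).
    apply: le_lebesgue_rV => x [Qx /= xi] j; rewrite /= !mxE.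
    by case: eqP => [->|_]; rewrite ?xi ?lexx// Qx.
  apply: (le_trans (lebesgue_box_le b)).
  by rewrite lee_fin (bigD1 i)//= !mxE eqxx subrr maxxx mul0r.
have U2 A B : (mu (A `|` B) <= mu A + mu B)%E := outer_measureU2 mu A B.
have finU0 (F : 'I_n -> set 'rV[R]_n) : (forall i, mu (F i) = 0%E) ->
    mu (\bigcup_(i in [set: 'I_n]) F i) = 0%E.
  move=> F0; rewrite (_ : [set: 'I_n] = [set` 'I_n]); last first.
    by apply/seteqP; split.
  rewrite bigcup_pred; apply: (big_ind (fun A => mu A = 0%E)) => //.
  move=> A B A0 B0; apply/eqP; rewrite eq_le outer_measure_ge0 andbT.
  by apply: (le_trans (U2 A B)); rewrite A0 B0 adde0.
apply/eqP; rewrite eq_le outer_measure_ge0 andbT.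
pose lo i := face i (corner Q ord0 i).
pose hi i := face i (corner Q ord0 i + side Q).
apply: (@le_trans _ _ (mu (\bigcup_(i in [set: 'I_n]) lo i `|`
                           \bigcup_(i in [set: 'I_n]) hi i))).
  apply: le_lebesgue_rV => x [Qx /existsNP[i /negP]].
  have /andP[l u] := Qx i.
  rewrite negb_and -!leNgt => /orP[xl|ux]; [left|right]; exists i => //; split=> //=.
    by apply/eqP; rewrite eq_le xl l.
  by apply/eqP; rewrite eq_le ux u.
apply: (le_trans (U2 _ _)).
by rewrite !finU0 ?adde0// => i; exact: face0.
Qed.

Lemma lebesgueI_open_cube A Q : mu (A `&` open_cube Q) = mu (A `&` Q).
Proof.
apply/eqP; rewrite eq_le; apply/andP; split.
  apply: le_lebesgue_rV => x [Ax Qx]; split => // i.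
  by have /andP[/ltW-> /ltW->] := Qx i.
rewrite (open_cube_caratheodory Q (A `&` Q)).
rewrite [X in (_ + X)%E](_ : _ = 0%E) ?adde0; last first.
  apply/eqP; rewrite eq_le outer_measure_ge0 andbT -(lebesgue_cube_boundary Q).
  by apply: le_lebesgue_rV => x [[Ax Qx] nQx].
by apply: le_lebesgue_rV => x [[Ax Qx] oQx].
Qed.

Lemma nonoverlapping_null Q Q' : nonoverlapping Q Q' -> mu (Q `&` Q') = 0%E.
Proof.
rewrite /nonoverlapping !interior_cube => QQ'.
rewrite -lebesgueI_open_cube setIC -lebesgueI_open_cube setIC QQ'.
exact: outer_measure0.
Qed.

(** Cubes are replaced by their interiors, which are disjoint and carry the
    same measure; then summing the local estimates loses nothing. *)
Lemma lebesgue_nonoverlapping_bigcup (A : set (cube R n))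
    (X : cube R n -> set 'rV[R]_n) (Y : set 'rV[R]_n) (c : R) :
  countable A -> (forall Q Q', A Q -> A Q' -> Q <> Q' -> nonoverlapping Q Q') ->
  0 <= c -> (forall Q, A Q -> (mu (X Q) <= c%:E * mu (Y `&` Q))%E) ->
  (mu (\bigcup_(Q in A) X Q) <= c%:E * mu Y)%E.
Proof.
move=> cA ovA c0 XY; apply: (le_trans (outer_measure_esum mu X cA)).
apply: (@le_trans _ _ (\esum_(Q in A) (c%:E * mu (Y `&` open_cube Q)))%E).
  by apply: le_esum => Q AQ; rewrite lebesgueI_open_cube XY.
rewrite esumZl//; last by move=> Q; exact: outer_measure_ge0.
rewrite lee_wpmul2l//.
apply: caratheodory_esum_le => //.
  by move=> Q _; exact: open_cube_caratheodory.
move=> Q Q' AQ AQ' [x [Qx Q'x]]; apply: contrapT => QQ'.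
have := ovA _ _ AQ AQ' QQ'; rewrite /nonoverlapping !interior_cube.
by move=> /seteqP[/(_ x)] /(_ (conj Qx Q'x)).
Qed.

End lebesgue_cubes.

(** * Dyadic cubes *)

Section dyadic_cubes.
Context {R : realType} {n : nat}.
Implicit Types P Q C : cube R n.

Lemma cube_eq P Q : corner P = corner Q -> side P = side Q -> P = Q.
Proof.
case: P Q => [c s s0] [c' s' s'0] /= cc' ss'; subst c' s'.
by rewrite (bool_irrelevance s0 s'0).
Qed.

Lemma dyadic_child_side P Q : dyadic_child P Q -> side Q < side P.
Proof. by move=> [-> _]; have := side_gt0 P; lra. Qed.

Lemma dyadic_child_sub P Q : dyadic_child P Q -> Q `<=` P.
Proof.
move=> [sQ [e eQ]] x Qx i; have P0 := side_gt0 P.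
have := Qx i; rewrite eQ sQ; case: (e i) => /andP[? ?]; apply/andP; split; lra.
Qed.

Lemma dyadic_trans P Q C : dyadic P Q -> dyadic Q C -> dyadic P C.
Proof.
move=> PQ; elim=> [//|Q' C' _ PQ' ?].
exact: dyadic_step PQ' _.
Qed.

Lemma dyadic_child_dyadic P Q : dyadic_child P Q -> dyadic P Q.
Proof. by apply: dyadic_step; exact: dyadic_root. Qed.

Lemma dyadic_sub P Q : dyadic P Q -> Q `<=` P.
Proof.
elim=> [//|Q' C _ PQ' /dyadic_child_sub Q'C].
exact: subset_trans PQ'.
Qed.

Lemma dyadic_side_le P Q : dyadic P Q -> side Q <= side P.
Proof.
elim=> [//|Q' C _ + /dyadic_child_side/ltW].
by move=> /[swap]; exact: le_trans.
Qed.

Lemma dyadic_side_eq P Q : dyadic P Q -> side Q = side P -> Q = P.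
Proof.
case=> [//|Q' C /dyadic_side_le PQ' /dyadic_child_side Q'C] CP.
by move: (lt_le_trans Q'C PQ'); rewrite CP ltxx.
Qed.

Lemma dyadic_anti P Q : dyadic P Q -> dyadic Q P -> P = Q.
Proof.
move=> PQ QP; apply: (dyadic_side_eq QP).
by apply/eqP; rewrite eq_le (dyadic_side_le PQ) (dyadic_side_le QP).
Qed.

Lemma dyadic_inv P Q : dyadic P Q ->
  Q = P \/ exists2 C, dyadic_child P C & dyadic C Q.
Proof.
elim=> [|Q' C _ IH Q'C]; [by left|right].
case: IH => [Q'P|[C' PC' C'Q']].
  by exists C; [rewrite -Q'P|exact: dyadic_root].
by exists C' => //; exact: dyadic_step Q'C.
Qed.

Lemma nonoverlapping_sub P P' Q Q' :
  Q `<=` P -> Q' `<=` P' -> nonoverlapping P P' -> nonoverlapping Q Q'.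
Proof.
move=> QP Q'P' PP'; apply/seteqP; split => // x [Qx Q'x].
rewrite -PP'; split; [exact: interiorS Qx|exact: interiorS Q'x].
Qed.

Lemma overlapping_same_sub P Q C : C `<=` P -> C `<=` Q -> ~ nonoverlapping P Q.
Proof.
move=> CP CQ /(nonoverlapping_sub CP CQ); rewrite /nonoverlapping setIid.
rewrite interior_cube => /seteqP[+ _].
move=> /(_ (\row_i (corner C ord0 i + side C / 2))); apply => i.
have C0 := side_gt0 C; rewrite mxE; apply/andP; split; lra.
Qed.

Lemma dyadic_child_nonoverlapping P C C' :
  dyadic_child P C -> dyadic_child P C' -> C <> C' -> nonoverlapping C C'.
Proof.
move=> [sC [e eC]] [sC' [e' eC']] CC'; rewrite /nonoverlapping !interior_cube.
apply/seteqP; split=> // x [Cx C'x]; apply: CC'.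
apply: cube_eq; last by rewrite sC sC'.
apply/rowP => i; have P0 := side_gt0 P.
have := Cx i; have := C'x i; rewrite eC eC' sC sC'.
by case: (e i); case: (e' i) => //= /andP[? ?] /andP[? ?]; lra.
Qed.

(** Induction on the descent to [Q]: the only new case is when the parent of
    [Q] contains [Q'] strictly, and then [Q'] lies in [Q] or in one of its
    siblings. *)
Lemma dyadic_nested R0 Q Q' : dyadic R0 Q -> dyadic R0 Q' ->
  [\/ dyadic Q Q', dyadic Q' Q | nonoverlapping Q Q'].
Proof.
move=> + RQ'; elim=> [|P C _ [PQ'|Q'P|PQ'] PC].
- by constructor 1.
- have [->|[C' PC' C'Q']] := dyadic_inv PQ'.
    by constructor 2; exact: dyadic_child_dyadic.
  have [->|CC'] := pselect (C = C'); first by constructor 1.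
  constructor 3.
  apply: nonoverlapping_sub (dyadic_child_nonoverlapping PC PC' CC') => //.
  exact: dyadic_sub.
- by constructor 2; exact: dyadic_step PC.
- constructor 3; apply: nonoverlapping_sub PQ' => //.
  exact: dyadic_child_sub.
Qed.

Lemma dyadic_parent_uniq R0 P P' Q : dyadic R0 P -> dyadic R0 P' ->
  dyadic_child P Q -> dyadic_child P' Q -> P = P'.
Proof.
move=> RP RP' PQ P'Q.
have sPP' : side P = side P' by case: PQ P'Q => [? _] [? _]; lra.
have [/dyadic_side_eq->//|/dyadic_side_eq->//|] := dyadic_nested RP RP'.
by move=> /(@overlapping_same_sub _ _ Q)[]; exact: dyadic_child_sub.
Qed.

Lemma dyadic_parentE R0 P Q : dyadic R0 P -> dyadic_child P Q ->
  dyadic_parent R0 Q = P.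
Proof.
move=> RP PQ; rewrite /dyadic_parent.
set S := [set P0 | _]; have SP : S P by [].
have [RP' P'Q] : S (xget Q S) by apply: xgetI SP.
exact: (dyadic_parent_uniq RP' RP P'Q PQ).
Qed.

Fixpoint generation P k : set (cube R n) :=
  if k is k'.+1 then \bigcup_(Q in generation P k') dyadic_child Q else [set P].

Lemma generation_dyadic P k Q : generation P k Q -> dyadic P Q.
Proof.
elim: k Q => [Q ->|k IH Q [Q' /IH PQ' Q'Q]]; first exact: dyadic_root.
exact: dyadic_step Q'Q.
Qed.

Lemma dyadic_generation P Q : dyadic P Q -> exists k, generation P k Q.
Proof.
elim=> [|Q' C _ [k Q'k] Q'C]; first by exists 0.
by exists k.+1, Q'.
Qed.

Lemma generation_side P k Q : generation P k Q -> side Q = side P / 2 ^+ k.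
Proof.
elim: k Q => [Q ->|k IH Q [Q' /IH PQ' [-> _]]]; first by rewrite expr0 divr1.
by rewrite PQ' exprSr invfM mulrA.
Qed.

Lemma generation_nonoverlapping P k Q Q' :
  generation P k Q -> generation P k Q' -> Q <> Q' -> nonoverlapping Q Q'.
Proof.
move=> kQ kQ' QQ'.
have sQQ' : side Q = side Q' by rewrite (generation_side kQ) (generation_side kQ').
have := dyadic_nested (generation_dyadic kQ) (generation_dyadic kQ').
by case=> // /dyadic_side_eq QQ; exfalso; apply: QQ'; rewrite QQ.
Qed.

Lemma generation_finite P k : finite_set (generation P k).
Proof.
elim: k => [|k IH]; first exact: finite_set1.
apply: bigcup_finite => // Q _.
have Q20 : 0 < side Q / 2 by rewrite divr_gt0// side_gt0.
pose child (e : {ffun 'I_n -> bool}) :=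
  Cube (\row_i (corner Q ord0 i + if e i then side Q / 2 else 0)) Q20.
apply: (@sub_finite_set _ _ (child @` setT)).
  move=> C [sC [e eC]]; exists [ffun i => e i] => //.
  by apply: cube_eq => //=; apply/rowP => i; rewrite mxE ffunE eC.
exact/finite_image/finite_finset.
Qed.

Lemma generation_cover P k : P `<=` \bigcup_(Q in generation P k) Q.
Proof.
elim: k => [x Px|k IH x /IH[Q kQ Qx]]; first by exists P.
have Q20 : 0 < side Q / 2 by rewrite divr_gt0// side_gt0.
pose e i := corner Q ord0 i + side Q / 2 <= x ord0 i.
pose C := Cube (\row_i (corner Q ord0 i + if e i then side Q / 2 else 0)) Q20.
exists C; first by exists Q => //; split=> //; exists e => i; rewrite mxE.
move=> i; rewrite /= mxE; have := Qx i; rewrite /e; case: ifP.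
  by move=> ? /andP[? ?]; apply/andP; split; lra.
move=> /negbT; rewrite -ltNge => ? /andP[? ?]; apply/andP; split; lra.
Qed.

Lemma dyadic_countable P : countable [set Q | dyadic P Q].
Proof.
have -> : [set Q | dyadic P Q] = \bigcup_k generation P k.
  apply/seteqP; split => [Q /dyadic_generation[k kQ]|Q [k _ /generation_dyadic//]].
  by exists k.
by apply: bigcup_countable => // k _; exact/finite_set_countable/generation_finite.
Qed.

End dyadic_cubes.

Section maximal_cubes.
Context {R : realType} {n : nat}.
Implicit Types P Q S : cube R n.

Definition maximal_cubes (A : set (cube R n)) : set (cube R n) :=
  [set S | A S /\ forall Q, A Q -> dyadic Q S -> Q = S].

Variables (R0 : cube R n) (A : set (cube R n)).
Hypothesis A_dyadic : A `<=` dyadic R0.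

(** Descending from [R0] towards [Q], the first cube of [A] that is met is
    maximal, because a dyadic cube has a unique chain of ancestors. *)
Lemma maximal_cubes_cover Q : A Q -> exists2 S, maximal_cubes A S & dyadic S Q.
Proof.
move=> AQ.
suff [//|/(_ _ AQ)[]] : (exists2 S, maximal_cubes A S & dyadic S Q) \/
    (forall S, A S -> ~ dyadic S Q).
  exact: dyadic_root.
elim: (A_dyadic AQ) => {Q AQ} [|P Q RP [[S maxS SP]|noP] PQ].
- have [AR|nAR] := pselect (A R0).
    left; exists R0; last exact: dyadic_root.
    by split => // S /A_dyadic RS SR; exact: dyadic_anti.
  right => S AS SR; apply: nAR.
  by rewrite -(dyadic_anti SR (A_dyadic AS)).
- by left; exists S => //; exact: dyadic_step PQ.
- have none S : A S -> dyadic S Q -> S = Q.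
    move=> AS SQ; case: SQ AS PQ => [//|P' Q' SP' P'Q' AS PQ'].
    have P'P : P' = P.
      exact: (dyadic_parent_uniq (dyadic_trans (A_dyadic AS) SP') RP P'Q' PQ').
    by case: (noP _ AS); rewrite -P'P.
  have [AQ|nAQ] := pselect (A Q).
    by left; exists Q => //; exact: dyadic_root.
  by right => S AS /(none _ AS) SQ; apply: nAQ; rewrite -SQ.
Qed.

Lemma maximal_cubes_nonoverlapping S S' :
  maximal_cubes A S -> maximal_cubes A S' -> S <> S' -> nonoverlapping S S'.
Proof.
move=> [AS maxS] [AS' maxS'] SS'.
have [/(maxS' _ AS)//|/(maxS _ AS')/esym//|//] :=
  dyadic_nested (A_dyadic AS) (A_dyadic AS').
Qed.

Lemma maximal_cubes_parent P S : maximal_cubes A S -> dyadic_child P S -> ~ A P.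
Proof.
move=> [AS maxS] PS AP; have := dyadic_child_side PS.
by rewrite (maxS _ AP (dyadic_child_dyadic PS)) ltxx.
Qed.

End maximal_cubes.

(** * Sets that are sparse in every dyadic cube *)

Section dyadic_density.
Context {R : realType} {n : nat}.
Local Notation mu := (@lebesgue_rV R n).
Variables (P : cube R n) (F : set 'rV[R]_n) (theta : R).
Hypothesis (theta0 : 0 <= theta) (FP : F `<=` P).
Hypothesis sparseF :
  forall Q, dyadic P Q -> (mu (F `&` Q) <= theta%:E * mu Q)%E.

(** The dyadic cubes of a generation that meet the box [b] are nonoverlapping
    and contained in a slight enlargement of [b], so [F] fills at most the
    fraction [theta] of that enlargement, whose volume tends to that of [b] as
    the generation increases. *)
Lemma lebesgue_sparse_box (b : 'rV[R]_n * 'rV[R]_n) :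
  (mu (F `&` box b) <= theta%:E * box_volume b)%E.
Proof.
have [[x0 bx0]|b0] := pselect (box b !=set0); last first.
  rewrite (_ : F `&` box b = set0) ?lebesgue_rV0.
    by apply: mule_ge0; [rewrite lee_fin|exact: box_volume_ge0].
  by apply/seteqP; split => // x [_ bx]; apply: b0; exists x.
pose vol h := \prod_(i < n) (b.2 ord0 i - b.1 ord0 i + 2 * h).
have b12 i : b.1 ord0 i <= b.2 ord0 i by have /andP[] := bx0 i; exact: le_trans.
have vol_b : box_volume b = (vol 0)%:E.
  congr EFin; apply: eq_bigr => i _.
  by rewrite mulr0 addr0 max_r// subr_ge0.
pose h k := side P / 2 ^+ k.
have le_grid k : (mu (F `&` box b) <= (theta * vol (h k))%:E)%E.
  have hk0 : 0 < h k by rewrite divr_gt0 ?side_gt0// exprn_gt0.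
  pose A := [set Q | generation P k Q /\ Q `&` box b !=set0].
  pose bh : 'rV[R]_n * 'rV[R]_n :=
    (\row_i (b.1 ord0 i - h k), \row_i (b.2 ord0 i + h k)).
  have A_bh Q : A Q -> Q `<=` box bh.
    move=> [kQ [y [Qy bxy]]] x Qx i; rewrite !mxE.
    have := bxy i; have := Qy i; have := Qx i; rewrite (generation_side kQ) -/(h k).
    by move=> /andP[? ?] /andP[? ?] /andP[? ?]; apply/andP; split; lra.
  apply: (@le_trans _ _ (theta%:E * mu (box bh))%E); last first.
    rewrite EFinM lee_wpmul2l//; apply: (le_trans (lebesgue_box_le bh)).
    rewrite lee_fin ler_prod// => i _; rewrite le_max lexx/= !mxE.
    by have b12i := b12 i; rewrite ge_max; apply/andP; split; lra.
  apply: (@le_trans _ _ (mu (\bigcup_(Q in A) (F `&` Q)))).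
    apply: le_lebesgue_rV => x [Fx bx].
    have [Q kQ Qx] := @generation_cover _ _ P k x (FP Fx).
    by exists Q => //; split => //; exists x.
  apply: lebesgue_nonoverlapping_bigcup => // [|Q Q' [kQ _] [kQ' _]|Q AQ].
  - apply/finite_set_countable/(sub_finite_set _ (generation_finite P k)).
    by move=> Q [].
  - exact: generation_nonoverlapping kQ kQ'.
  - rewrite (setIidr (A_bh _ AQ)); apply: sparseF.
    by case: AQ => /generation_dyadic.
have Ffin : mu (F `&` box b) \is a fin_num.
  rewrite ge0_fin_numE; last exact: outer_measure_ge0.
  exact: le_lt_trans (le_grid 0%N) (ltry _).
rewrite -(fineK Ffin) vol_b -EFinM lee_fin leNgt; apply/negP => lt_m.
have h0 : h @ \oo --> (0 : R).
  have -> : h = geometric (side P) (2^-1).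
    by apply/funext => k; rewrite /h/= exprVn.
  by apply: cvg_geometric; rewrite ger0_norm; lra.
have vol0 : (theta * vol (h k)) @[k --> \oo] --> theta * vol 0.
  apply: cvgMr; apply: cvg_big => [|i _]; first exact: mul_continuous.
  apply: cvgD; first exact: cvg_cst.
  by apply: cvgMr.
have [k hk] := filter_ex (cvgr_lt _ vol0 _ lt_m).
by have := le_grid k; rewrite -(fineK Ffin) lee_fin leNgt hk.
Qed.

(** Summing [lebesgue_sparse_box] over a cover of [F] and taking the infimum
    over the covers shows that the measure of [F] is at most [theta] times
    itself. *)
Lemma lebesgue_sparse_null : theta < 1 -> mu F = 0%E.
Proof.
move=> theta1.
have Ffin : mu F \is a fin_num.
  rewrite ge0_fin_numE; last exact: outer_measure_ge0.
  apply: le_lt_trans (le_lebesgue_rV FP) _.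
  by rewrite -ge0_fin_numE ?lebesgue_rV_ge0// lebesgue_cube_fin.
(* theta may be 0, which is not invertible; any larger number below 1 will do. *)
pose theta' := (1 + theta) / 2.
have [tt' t'1] : theta <= theta' /\ theta' < 1 by rewrite /theta'; split; lra.
have t'0 : 0 < theta' by rewrite /theta'; move: theta0; lra.
suff : (mu F <= theta'%:E * mu F)%E.
  rewrite -(fineK Ffin) -EFinM lee_fin => le_F.
  have : 0 <= fine (mu F) by rewrite fine_ge0// lebesgue_rV_ge0.
  rewrite le_eqVlt => /predU1P[<-//|F0].
  by move: le_F; rewrite -ler_pdivrMr// divff ?lt0r_neq0// leNgt t'1.
rewrite -lee_pdivrMl//; apply: le_ereal_inf_tmp => _ [S [cS FS] <-].
rewrite lee_pdivrMl// -esumZl//; last exact: ltW;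
  last by move=> b; exact: box_volume_ge0.
apply: (@le_trans _ _ (\esum_(b in S) mu (F `&` box b))%E).
  apply: le_trans (outer_measure_esum mu (fun b => F `&` box b) cS).
  by apply: le_lebesgue_rV => x Fx; have [b Sb bx] := FS _ Fx; exists b.
apply: le_esum => b _; apply: (le_trans (lebesgue_sparse_box b)).
by rewrite lee_wpmul2r ?box_volume_ge0// lee_fin.
Qed.

End dyadic_density.

(** * Medians and local oscillation *)

Section median_oscillation.
Context {R : realType} {n : nat}.
Local Notation mu := (@lebesgue_rV R n).
Implicit Types (Q : cube R n) (f : 'rV[R]_n -> R) (X : set 'rV[R]_n).

Definition deviation_set f (c a : R) : set 'rV[R]_n :=
  [set y | (a < `|f y - c|)%R].

Lemma lebesgueI_cube_fin Q X : mu (Q `&` X) \is a fin_num.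
Proof.
rewrite ge0_fin_numE; last exact: lebesgue_rV_ge0.
apply: (@le_lt_trans _ _ (mu Q)); first by apply: le_lebesgue_rV => x [].
by rewrite -ge0_fin_numE ?lebesgue_rV_ge0// lebesgue_cube_fin.
Qed.

(** Below c - a the function f takes its values on a set of measure less than
    u |Q| <= t |Q|, and below any M > c + a on a set of measure more than
    (1 - u) |Q| >= t |Q|. *)
Lemma median_close f (t u a c : R) Q : (0 < mu Q)%E -> u <= t -> u <= 1 - t ->
  (mu (Q `&` deviation_set f c a) < u%:E * mu Q)%E ->
  `|median f t Q - c| <= a.
Proof.
move=> Q0 ut u1t devQ; rewrite /median; set S := [set M | _].
have Sca : S (c - a).
  apply: (@le_trans _ _ (u%:E * mu Q)%E); last first.
    by rewrite lee_wpmul2r ?lebesgue_rV_ge0// lee_fin.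
  apply: le_trans (ltW devQ); apply: le_lebesgue_rV => y [Qy /= fy].
  by split => //; rewrite /deviation_set/= ltr_normr; apply/orP; right; lra.
have ubS : ubound S (c + a).
  move=> M SM; rewrite leNgt; apply/negP => caM.
  suff : (mu Q < mu Q)%E by rewrite ltxx.
  apply: (@le_lt_trans _ _ (mu (Q `&` deviation_set f c a) +
      mu (Q `&` [set y | (f y < M)%R]))%E).
    have U2 A B : (mu (A `|` B) <= mu A + mu B)%E := outer_measureU2 mu A B.
    apply: le_trans (U2 _ _); apply: le_lebesgue_rV => y Qy.
    have [ay|ya] := ltP a `|f y - c|; [by left|right; split => //=].
    by move: ya; rewrite ler_norml => /andP[? ?]; lra.
  apply: (@lt_le_trans _ _ (u%:E * mu Q + t%:E * mu Q)%E).
    apply: lte_leD => //; first exact: lebesgueI_cube_fin.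
  rewrite -muleDl ?lebesgue_cube_fin// -EFinD -[leRHS]mul1e.
  by rewrite lee_wpmul2r ?lebesgue_rV_ge0// lee_fin; lra.
have supS : has_sup S by split; [exists (c - a)|exists (c + a)].
rewrite ler_norml; apply/andP; split.
  by rewrite lerBrDl; apply: ub_le_sup => //; exists (c + a).
by rewrite lerBlDl; apply: ge_sup => //; exists (c - a).
Qed.

Lemma local_oscillation_ge0 s f Q : (0 <= local_oscillation s f Q)%E.
Proof.
apply: le_ereal_inf_tmp => _ [c _ <-]; apply: le_ereal_inf_tmp => _ [a [a0 _] <-].
by rewrite lee_fin.
Qed.

Lemma local_oscillation_lt s f Q (l : R) : (local_oscillation s f Q < l%:E)%E ->
  exists c a, [/\ 0 <= a, a < l &
    (mu (Q `&` deviation_set f c a) < s%:E * mu Q)%E].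
Proof.
move=> /ereal_inf_lt[_ [c _ <-]] /ereal_inf_lt[_ [a [a0 Qa] <-]].
by rewrite lte_fin => al; exists c, a.
Qed.

Lemma deviation_set_caratheodory (Q0 : cube R n) f Q (c a : R) :
  lebesgue_measurable_fun Q0 f -> Q `<=` Q0 ->
  mu.-caratheodory (Q `&` deviation_set f c a).
Proof.
move=> mf QQ0.
rewrite (_ : _ `&` _ =
    Q `&` (Q0 `&` f @^-1` [set z | (a < `|z - c|)%R])); last first.
  by rewrite setIA (setIidl QQ0).
apply: caratheodory_measurable_setI; first exact: cube_caratheodory.
apply: mf; first exact: cube_caratheodory.
have -> : [set z : R | a < `|z - c|] =
    `]c + a, +oo[%classic `|` `]-oo, c - a[%classic.
  apply/seteqP; split => z; rewrite /= !in_itv/= andbT ltr_normr.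
    by move=> /orP[] ?; [left|right]; lra.
  by move=> [] ?; apply/orP; [left|right]; lra.
by apply: measurableU; exact: measurable_itv.
Qed.

Lemma deviation_setS f (c c' a a' : R) : a + `|c - c'| <= a' ->
  deviation_set f c' a' `<=` deviation_set f c a.
Proof.
move=> aa' y; rewrite /deviation_set/= => a'y.
have := ler_distD c (f y) c'; lra.
Qed.

(** The sets where |f| > k decrease to the empty set. *)
Lemma local_oscillation_fin (s : R) (Q0 : cube R n) f Q : 0 < s ->
  (0 < mu Q)%E -> lebesgue_measurable_fun Q0 f -> Q `<=` Q0 ->
  local_oscillation s f Q \is a fin_num.
Proof.
move=> s0 Q_gt0 mf QQ0; rewrite ge0_fin_numE; last exact: local_oscillation_ge0.
pose F k := Q `&` deviation_set f 0 k%:R.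
have mF k : mu.-caratheodory (F k) by exact: deviation_set_caratheodory mf QQ0.
have F0 : \bigcap_k F k = set0.
  apply/seteqP; split => // y Fy.
  have [_] := Fy (Num.Def.truncn `|f y - 0|).+1 I.
  by rewrite /deviation_set/= ltNge => /negP; apply; rewrite ltW// truncnS_gt.
have cvgF : (mu \o F) x @[x --> \oo] --> mu (\bigcap_n F n).
  apply: (nonincreasing_cvg_mu (mu:=@lebesgue_caratheodory R n)) => //.
  - by rewrite -ge0_fin_numE ?lebesgue_rV_ge0// lebesgueI_cube_fin.
  - by rewrite F0; exact: measurable0.
  - move=> i j ij; apply/subsetPset; apply: setIS => y; rewrite /deviation_set/=.
    by apply: le_lt_trans; rewrite ler_nat.
have sQ0 : (mu (\bigcap_n F n) < s%:E * mu Q)%E.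
  by rewrite F0 lebesgue_rV0 mule_gt0 ?lte_fin.
have [k Fk] : exists k, (mu (F k) < s%:E * mu Q)%E.
  apply: contrapT => /forallNP noF; move: sQ0; rewrite ltNge => /negP; apply.
  rewrite -(cvg_lim _ cvgF)//; apply: lime_ge.
    by apply/cvg_ex; eexists; exact: cvgF.
  by apply: nearW => k; rewrite leNgt; apply/negP/noF.
apply: (@le_lt_trans _ _ k%:R%:E); last exact: ltry.
apply: (@le_trans _ _ (ereal_inf [set a%:E | a in [set a : R | 0 <= a /\
    (mu (Q `&` [set y | (a < `|f y - 0|)%R]) < s%:E * mu Q)%E]])).
  by apply: ereal_inf_lbound; exists 0.
by apply: ereal_inf_lbound; exists k%:R.
Qed.

(** Above the oscillation o, some constant c and a < o + 1 / (k + 1) satisfy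
    |f - c| <= a off a set of measure less than s |Q|, and the median is within
    a of c. This gives the bound with 2 o + 2 / (k + 1) in place of 2 o, and
    continuity from below removes the excess. *)
Lemma lebesgue_median_deviation (s t : R) (Q0 : cube R n) f Q : 0 < s < 1 / 2 ->
  1 / 2 <= t < 1 - s -> (0 < mu Q)%E -> lebesgue_measurable_fun Q0 f ->
  Q `<=` Q0 ->
  (mu (Q `&` deviation_set f (median f t Q)
    (2 * fine (local_oscillation s f Q))) <= s%:E * mu Q)%E.
Proof.
move=> /andP[s0 s12] /andP[t12 t1s] Q_gt0 mf QQ0.
have osc_fin := local_oscillation_fin s0 Q_gt0 mf QQ0.
set m := median f t Q; set o := fine _.
pose F (k : nat) := Q `&` deviation_set f m (2 * o + 2 * k.+1%:R^-1).
have FE : Q `&` deviation_set f m (2 * o) = \bigcup_k F k.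
  apply/seteqP; split => [y [Qy oy]|y [k _ [Qy ky]]].
    have d0 : 0 < (`|f y - m| - 2 * o) / 2.
      by rewrite divr_gt0// subr_gt0.
    have [k _ /(_ k (leqnn _)) kd] := near_infty_natSinv_lt (PosNum d0).
    exists k => //; split => //; rewrite /deviation_set/=.
    have {}kd : k.+1%:R^-1 < (`|f y - m| - 2 * o) / 2 := kd.
    by move: kd; set z := k.+1%:R^-1; lra.
  split => //; move: ky; rewrite /deviation_set/=; apply: lt_trans.
  by rewrite ltrDl mulr_gt0 ?invr_gt0.
have Fs k : (mu (F k) <= s%:E * mu Q)%E.
  have [] := @local_oscillation_lt s f Q (o + k.+1%:R^-1).
    by rewrite -(fineK osc_fin) lte_fin ltrDl invr_gt0.
  move=> c [a [a0 ao Qa]]; apply: le_trans (ltW Qa).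
  apply: le_lebesgue_rV; apply: setIS; apply: deviation_setS.
  have : `|c - m| <= a.
    rewrite distrC; apply: median_close Qa => //; lra.
  by move: ao; set z := k.+1%:R^-1; lra.
rewrite FE.
have cvgF : (mu \o F) x @[x --> \oo] --> mu (\bigcup_n F n).
  apply: (nondecreasing_cvg_mu (mu:=@lebesgue_caratheodory R n)) => //.
  - by move=> k; exact: deviation_set_caratheodory mf QQ0.
  - rewrite -FE; exact: deviation_set_caratheodory mf QQ0.
  - move=> i j ij; apply/subsetPset; apply: setIS => y; rewrite /deviation_set/=.
    apply: le_lt_trans; rewrite lerD2l ler_pM2l// lef_pV2 ?posrE// ler_nat.
    by rewrite ltnS.
rewrite -(cvg_lim _ cvgF)//; apply: lime_le.
  by apply/cvg_ex; eexists; exact: cvgF.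
by apply: nearW => k; exact: Fs.
Qed.

End median_oscillation.

(** * Median of a dyadic cube and of its parent *)

Section slow_sequences.
Context {R : realType}.
Implicit Types (c V : nat -> R) (l : R).

(** If c j > c i + 6 l, the first value exceeding c i + 2 l is at most
    c i + 4 l, hence more than 2 l away from both ends. *)
Lemma slow_two_cluster_le c l i j : 0 <= l -> (i <= j)%N ->
  (forall k, (i <= k < j)%N -> c k.+1 <= c k + 2 * l) ->
  (forall p, (i <= p <= j)%N ->
    ~ [/\ 2 * l < c p - c i & 2 * l < c j - c p]) ->
  c j <= c i + 6 * l.
Proof.
move=> l0 ij step sep; rewrite leNgt; apply/negP => far.
pose above p := (i <= p <= j)%N && (c i + 2 * l < c p).
have ex_above : exists p, above p.
  by exists j; rewrite /above ij leqnn/=; lra.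
case: (ex_minnP ex_above) => p /andP[/andP[ip pj] cp] minp.
have ip' : (i < p)%N.
  by rewrite ltn_neqAle ip andbT; apply: contraTneq cp => ->; rewrite -leNgt; lra.
case: p => // p in ip pj cp minp ip' *.
have cp' : c p <= c i + 2 * l.
  rewrite leNgt; apply/negP => cp'.
  have : above p by rewrite /above -ltnS ip' (ltnW pj).
  by move=> /minp; rewrite ltnn.
have := step p; rewrite -ltnS ip' pj => /(_ isT) stepp.
by apply: (sep p.+1); [rewrite ip|split; lra].
Qed.

Lemma slow_two_cluster c l i j : 0 <= l -> (i <= j)%N ->
  (forall k, (i <= k < j)%N -> `|c k.+1 - c k| <= 2 * l) ->
  (forall p, (i <= p <= j)%N ->
    ~ [/\ 2 * l < `|c p - c i|, 2 * l < `|c j - c p| & 2 * l < `|c j - c i|]) ->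
  `|c j - c i| <= 6 * l.
Proof.
move=> l0 ij step sep; rewrite ler_norml; apply/andP; split.
  rewrite -(lerN2 (c j - c i)) opprK opprB.
  have := @slow_two_cluster_le (fun k => - c k) l i j l0 ij.
  move=> h; have : - c j <= - c i + 6 * l; last by lra.
  apply: h => [k /step|p /sep sepp].
    by rewrite ler_norml => /andP[? ?]; lra.
  move=> [? ?]; apply: sepp; split; rewrite ltr_normr; apply/orP; right; lra.
have : c j <= c i + 6 * l; last by lra.
apply: slow_two_cluster_le => // [k /step|p /sep sepp].
  by rewrite ler_norml => /andP[? ?]; lra.
move=> [? ?]; apply: sepp; split; rewrite ltr_normr; apply/orP; left; lra.
Qed.

(** Here [V k] plays the role of the volume of the k-th cube and [c k] that of
    a constant approximating f there. Cut the indices where [V] has doubled: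
    each piece contributes 6 l by [slow_two_cluster], and passing to the next
    piece costs one step, 2 l. *)
Lemma slow_doubling c V l N : 0 <= l -> {homo V : i j / (i <= j)%N >-> i <= j} ->
  (forall k, 0 < V k) ->
  (forall k, (k < N)%N -> `|c k.+1 - c k| <= 2 * l) ->
  (forall i j k, (i <= j)%N -> (j <= k)%N -> (k <= N)%N -> V k <= 2 * V i ->
    ~ [/\ 2 * l < `|c j - c i|, 2 * l < `|c k - c j| & 2 * l < `|c k - c i|]) ->
  forall d i, (i <= N)%N -> V N <= 2 ^+ d.+1 * V i ->
  `|c N - c i| <= (8 * d + 6)%:R * l.
Proof.
move=> l0 Vle V0 step sep d.
have cluster i j : (i <= j)%N -> (j <= N)%N -> V j <= 2 * V i ->
    `|c j - c i| <= 6 * l.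
  move=> ij jN Vij; apply: slow_two_cluster => // [k /andP[_ kj]|p /andP[ip pj]].
    by apply: step; exact: leq_trans jN.
  exact: sep.
elim: d => [i iN VN|d IH i iN VN].
  by apply: cluster; rewrite // -[2]expr1.
have [V2|V2] := leP (V N) (2 * V i).
  apply: le_trans (cluster _ _ iN (leqnn _) V2) _.
  by rewrite ler_wpM2r// ler_nat; lia.
pose big j := (i <= j <= N)%N && (2 * V i < V j).
have ex_big : exists j, big j by exists N; rewrite /big iN leqnn.
case: (ex_minnP ex_big) => -[|j] /andP[/andP[ij jN] Vj] minj.
  move: ij Vj; rewrite leqn0 => /eqP ->; have := V0 0; lra.
have ij' : (i <= j)%N.
  move: ij; rewrite leq_eqVlt => /predU1P[ij|//].
  by move: Vj; rewrite -ij; have := V0 i; lra.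
have Vj' : V j <= 2 * V i.
  rewrite leNgt; apply/negP => Vj'.
  have : big j by rewrite /big ij' (ltnW jN).
  by move=> /minj; rewrite ltnn.
have h1 := cluster _ _ ij' (ltnW jN) Vj'.
have h2 := step _ jN.
have h3 : `|c N - c j.+1| <= (8 * d + 6)%:R * l.
  apply: IH => //; apply: (le_trans VN).
  by rewrite exprSr -mulrA ler_pM2l ?exprn_gt0// ltW.
have -> : (8 * d.+1 + 6)%:R * l = (8 * d + 6)%:R * l + (2 * l + 6 * l).
  by rewrite -mulrDl -mulrDl -!natrD; congr (_%:R * _); lia.
have -> : c N - c i = (c N - c j.+1) + ((c j.+1 - c j) + (c j - c i)) by ring.
apply: le_trans (ler_normD _ _) (lerD h3 _).
by apply: le_trans (ler_normD _ _) (lerD h2 h1).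
Qed.

End slow_sequences.

Section parent_median.
Context {R : realType} {n : nat}.
Local Notation mu := (@lebesgue_rV R n).
Implicit Types (P Q : cube R n) (f : 'rV[R]_n -> R) (X : set 'rV[R]_n).

Let vol Q := fine (mu Q).

Let volE Q : mu Q = (vol Q)%:E.
Proof. by rewrite fineK// lebesgue_cube_fin. Qed.

(** The two exceptional sets are too small to cover [Q1]. *)
Lemma deviation_overlap f (s l c1 c2 : R) Q1 Q2 : Q1 `<=` Q2 ->
  (s%:E * mu Q2 <= (1 - s)%:E * mu Q1)%E ->
  (mu (Q1 `&` deviation_set f c1 l) < s%:E * mu Q1)%E ->
  (mu (Q2 `&` deviation_set f c2 l) < s%:E * mu Q2)%E ->
  `|c2 - c1| <= 2 * l.
Proof.
move=> Q12; rewrite !volE -!EFinM lee_fin => sQ d1 d2.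
rewrite leNgt; apply/negP => far.
suff : (mu Q1 < mu Q1)%E by rewrite ltxx.
have U2 A B : (mu (A `|` B) <= mu A + mu B)%E := outer_measureU2 mu A B.
apply: (@le_lt_trans _ _ (mu (Q1 `&` deviation_set f c1 l) +
                          mu (Q2 `&` deviation_set f c2 l))%E).
  apply: le_trans (U2 _ _); apply: le_lebesgue_rV => y Qy.
  have [ly|yl] := ltP l `|f y - c1|; [by left|right].
  split; first exact: Q12.
  rewrite /deviation_set/= ltNge; apply/negP => yl2.
  have := ler_distD (f y) c2 c1; rewrite [`|c2 - f y|]distrC; lra.
apply: (lt_le_trans (lteD d1 d2)).
rewrite volE -EFinD lee_fin; lra.
Qed.

(** Each cube carries a set of more than half of its measure on which f is
    within l of the corresponding constant. If the constants were pairwise more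
    than 2 l apart these sets would be disjoint, so that
    (|Q1| + |Q2| + |Q3|) / 2 < |Q3|, against |Q3| <= 2 |Q1| <= |Q1| + |Q2|. *)
Lemma deviation_three f (s l : R) (Q0 : cube R n) (c1 c2 c3 : R) Q1 Q2 Q3 :
  lebesgue_measurable_fun Q0 f -> s < 1 / 2 ->
  Q1 `<=` Q2 -> Q2 `<=` Q3 -> Q3 `<=` Q0 -> (mu Q3 <= 2%:E * mu Q1)%E ->
  (mu (Q1 `&` deviation_set f c1 l) < s%:E * mu Q1)%E ->
  (mu (Q2 `&` deviation_set f c2 l) < s%:E * mu Q2)%E ->
  (mu (Q3 `&` deviation_set f c3 l) < s%:E * mu Q3)%E ->
  ~ [/\ 2 * l < `|c2 - c1|, 2 * l < `|c3 - c2| & 2 * l < `|c3 - c1|].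
Proof.
move=> mf s12 Q12 Q23 Q30 Q3le d1 d2 d3 [c12 c23 c13].
pose G Q c := Q `\` (Q `&` deviation_set f c l).
have mG Q c : Q `<=` Q0 ->
    measurable (G Q c : set (caratheodory_type (@lebesgue_outer R n))).
  move=> QQ0; apply: measurableD; first exact: cube_caratheodory.
  exact: deviation_set_caratheodory mf QQ0.
have G_disj Q Q' c c' : 2 * l < `|c' - c| -> G Q c `&` G Q' c' = set0.
  move=> cc'; apply/seteqP; split=> // y [[Qy ny] [Q'y ny']].
  have yl : `|f y - c| <= l by rewrite leNgt; apply/negP => ?; apply: ny.
  have yl' : `|f y - c'| <= l by rewrite leNgt; apply/negP => ?; apply: ny'.
  have := ler_distD (f y) c' c; rewrite [`|c' - f y|]distrC; move: cc'.
  by rewrite /=; lra.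
have U2 A B : (mu (A `|` B) <= mu A + mu B)%E := outer_measureU2 mu A B.
have G_ge Q c : (mu (Q `&` deviation_set f c l) < s%:E * mu Q)%E ->
    ((1 - s)%:E * mu Q < mu (G Q c))%E.
  move=> dQ; have : (mu Q <= mu (G Q c) + mu (Q `&` deviation_set f c l))%E.
    apply: le_trans (U2 _ _); apply: le_lebesgue_rV => y Qy.
    by have [?|?] := pselect (deviation_set f c l y); [right|left; split => // -[]].
  have Gfin : mu (G Q c) \is a fin_num by rewrite /G setDE lebesgueI_cube_fin.
  move: dQ; rewrite volE -(fineK Gfin).
  rewrite -(fineK (lebesgueI_cube_fin Q (deviation_set f c l))).
  by rewrite -!EFinM -EFinD !lee_fin !lte_fin; lra.
have : (mu (G Q1 c1) + mu (G Q2 c2) + mu (G Q3 c3) <= mu Q3)%E.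
  have -> : (mu (G Q1 c1) + mu (G Q2 c2))%E = mu (G Q1 c1 `|` G Q2 c2).
    apply/esym/(measureU (@lebesgue_caratheodory R n));
      [apply: mG|apply: mG|exact: G_disj].
      exact: subset_trans Q12 (subset_trans Q23 Q30).
    exact: subset_trans Q23 Q30.
  have <- : mu (G Q1 c1 `|` G Q2 c2 `|` G Q3 c3) =
      (mu (G Q1 c1 `|` G Q2 c2) + mu (G Q3 c3))%E.
    apply: (measureU (@lebesgue_caratheodory R n));
      [apply: measurableU; apply: mG|exact: mG|].
    - exact: subset_trans Q12 (subset_trans Q23 Q30).
    - exact: subset_trans Q23 Q30.
    - by rewrite setIUl !G_disj// setU0.
  by apply: le_lebesgue_rV => y [[[/Q12/Q23]|[/Q23]]|[]].
move: (G_ge _ _ d1) (G_ge _ _ d2) (G_ge _ _ d3).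
have v1 : vol Q1 <= vol Q2.
  by rewrite -lee_fin -!volE; exact: le_lebesgue_rV.
have Gfin Q c : mu (G Q c) \is a fin_num by rewrite /G setDE lebesgueI_cube_fin.
move: Q3le; rewrite -(fineK (Gfin Q1 c1)) -(fineK (Gfin Q2 c2)).
rewrite -(fineK (Gfin Q3 c3)).
rewrite !volE -!EFinM -!EFinD !lee_fin !lte_fin.
have half Q : 1 / 2 * vol Q <= (1 - s) * vol Q.
  by apply: ler_wpM2r; [rewrite -lee_fin -volE; exact: lebesgue_rV_ge0|lra].
by have := half Q1; have := half Q2; have := half Q3; lra.
Qed.

(** With N steps from [Q] to its parent, consecutive volumes have a ratio of at
    most (1 + 1 / N)^n; this provides the N for which [deviation_overlap]
    applies. *)
Lemma slow_growth_steps (m : nat) (s : R) : 0 < s < 1 / 2 ->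
  exists N, s * (1 + N.+1%:R^-1) ^+ m <= 1 - s.
Proof.
move=> /andP[s0 s12].
have cvg1 : (s * (1 + k.+1%:R^-1) ^+ m : R) @[k --> \oo] --> s * (1 + 0) ^+ m.
  apply: cvgMr; apply: (@cvg_comp _ _ _ (fun k : nat => 1 + k.+1%:R^-1 : R)
    (fun x => x ^+ m) _ (nbhs (1 + 0 : R))); last exact: exprn_continuous.
  by apply: cvgD; [exact: cvg_cst|exact: cvg_harmonic].
have lim_lt : s * (1 + 0) ^+ m < 1 - s by rewrite addr0 expr1n; lra.
have [N /ltW sN] := filter_ex (cvgr_lt _ cvg1 _ lim_lt).
by exists N.
Qed.

(** The cubes [C k] of the proof grow from [Q] to [P], keeping fixed the vertex
    that [Q] shares with [P]. *)
Lemma median_child_le f (s t l : R) (Q0 : cube R n) P Q :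
  (0 < n)%N -> 0 < s < 1 / 2 -> 1 / 2 <= t < 1 - s ->
  lebesgue_measurable_fun Q0 f -> (0 < mu Q)%E ->
  P `<=` Q0 -> dyadic_child P Q -> 0 <= l ->
  (forall C : cube R n, Q `<=` C -> C `<=` P ->
    exists c, (mu (C `&` deviation_set f c l) < s%:E * mu C)%E) ->
  `|median f t Q - median f t P| <= (8 * n)%:R * l.
Proof.
move=> n0 s012 t1s mf muQ PQ0 PQ l0 devP.
have nE : (8 * n = 1 + (8 * n.-1 + 6 + 1))%N by clear - n0; lia.
have [s0 s12] := andP s012; have [t12 ts] := andP t1s.
have [N0 sN] := slow_growth_steps n s012.
pose N := N0.+1; have N_gt0 : 0 < N%:R :> R by rewrite ltr0n.
have [sQ [e eQ]] := PQ; have sideQ := side_gt0 Q.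
have sideP : side P = 2 * side Q by lra.
pose r k := k%:R / N%:R : R.
have r0 k : 0 <= r k by rewrite divr_ge0.
have rle j k : (j <= k)%N -> r j <= r k.
  by move=> jk; rewrite ler_wpM2r ?invr_ge0 ?ler0n// ler_nat.
have side_k k : 0 < side Q * (1 + r k).
  by rewrite mulr_gt0// ltr_wpDr.
pose C k := Cube (\row_i (corner P ord0 i +
  if e i then side Q * (1 - r k) else 0)) (side_k k).
have C0 : C 0 = Q.
  apply: cube_eq => /=; last by rewrite /r mul0r addr0 mulr1.
  by apply/rowP => i; rewrite mxE eQ /r mul0r subr0 mulr1 -sQ.
have CN : C N = P.
  apply: cube_eq => /=; last by rewrite /r divff ?lt0r_neq0// sideP mulrC.
  apply/rowP => i; rewrite mxE /r divff ?lt0r_neq0// subrr mulr0.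
  by case: ifP; rewrite addr0.
have Csub j k : (j <= k)%N -> C j `<=` C k.
  move=> /rle rjk x Cx i; have := Cx i; rewrite /= !mxE.
  have jk : side Q * r j <= side Q * r k by rewrite ler_pM2l.
  by case: (e i); rewrite !mulrDr mulr1 ?mulrN => /andP[? ?]; apply/andP; split; lra.
have CP k : (k <= N)%N -> C k `<=` P by rewrite -CN; exact: Csub.
have QC k : Q `<=` C k by rewrite -C0; exact: Csub.
have volC k : vol (C k) = (1 + r k) ^+ n * vol Q.
  apply: EFin_inj; rewrite -volE (lebesgue_cube_scale _ Q) volE -EFinM/=.
  by rewrite mulrAC divff ?mul1r// lt0r_neq0.
have volQ : 0 < vol Q by rewrite -lte_fin -volE.
have volC_gt0 k : 0 < vol (C k).
  by rewrite volC mulr_gt0// exprn_gt0// ltr_wpDr.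
have volC_le : {homo (vol \o C) : i j / (i <= j)%N >-> i <= j}.
  by move=> i j ij; rewrite /= -lee_fin -!volE; apply: le_lebesgue_rV; exact: Csub.
have /choice[c cP] : forall k, exists c, (k <= N)%N ->
    (mu (C k `&` deviation_set f c l) < s%:E * mu (C k))%E.
  move=> k; have [kN|_] := leqP k N; last by exists 0.
  by have [c] := devP _ (QC k) (CP _ kN); exists c.
have step k : (k < N)%N -> `|c k.+1 - c k| <= 2 * l.
  move=> kN; apply: (@deviation_overlap f s l _ _ (C k) (C k.+1)).
  - exact: Csub.
  - rewrite !volE -!EFinM lee_fin !volC mulrA [leRHS]mulrA ler_pM2r//.
    apply: le_trans (_ : s * ((1 + N%:R^-1) * (1 + r k)) ^+ n <= _).
      rewrite ler_pM2l// lerXn2r ?nnegrE ?addr_ge0 ?mulr_ge0 ?addr_ge0 ?invr_ge0//.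
      rewrite /r -natr1 mulrDl; set z := N%:R^-1.
      have : 0 <= z * (k%:R * z) by rewrite !mulr_ge0 ?invr_ge0//.
      by rewrite mul1r; lra.
    by rewrite exprMn mulrA ler_wpM2r// exprn_ge0// addr_ge0.
  - exact/cP/ltnW.
  - exact: cP.
have sep i j k : (i <= j)%N -> (j <= k)%N -> (k <= N)%N ->
    vol (C k) <= 2 * vol (C i) ->
    ~ [/\ 2 * l < `|c j - c i|, 2 * l < `|c k - c j| & 2 * l < `|c k - c i|].
  move=> ij jk kN Vki.
  apply: (deviation_three mf s12 (Csub _ _ ij) (Csub _ _ jk)).
  - exact: subset_trans (CP _ kN) PQ0.
  - by rewrite !volE -EFinM lee_fin.
  - exact: cP (leq_trans (leq_trans ij jk) kN).
  - exact: cP (leq_trans jk kN).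
  - exact: cP.
have cN0 : `|c N - c 0| <= (8 * n.-1 + 6)%:R * l.
  apply: (slow_doubling l0 volC_le volC_gt0 step sep) => //=.
  by rewrite !volC prednK// {2}/r mul0r addr0 expr1n mul1r /r divff ?lt0r_neq0//.
have mQ : `|median f t Q - c 0| <= l.
  have := cP 0 (leq0n _); rewrite C0; apply: median_close => //; lra.
have mP : `|median f t P - c N| <= l.
  have := cP N (leqnn _); rewrite CN; apply: median_close; [|lra|lra].
  by rewrite -CN volE lte_fin.
have -> : (8 * n)%:R * l = l + ((8 * n.-1 + 6)%:R * l + l).
  by rewrite nE !natrD !mulrDl mul1r.
have -> : median f t Q - median f t P =
  (median f t Q - c 0) - ((c N - c 0) + (median f t P - c N)) by ring.
apply: le_trans (ler_normB _ _) (lerD mQ _).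
by apply: le_trans (ler_normD _ _) (lerD cN0 mP).
Qed.

(** Every cube between [Q] and [P] contains y, so its oscillation is at most the
    sharp maximal function at y, to which [median_child_le] is applied with an
    arbitrarily small excess. *)
Lemma median_parent_le f (s t : R) (Q0 : cube R n) P Q :
  (0 < n)%N -> 0 < s < 1 / 2 -> 1 / 2 <= t < 1 - s ->
  lebesgue_measurable_fun Q0 f -> (0 < mu Q)%E ->
  P `<=` Q0 -> dyadic_child P Q ->
  (`|median f t Q - median f t P|%:E <=
    (10 * n)%:R%:E * ereal_inf [set local_sharp s P f y | y in Q])%E.
Proof.
move=> n0 s012 t1s mf muQ PQ0 PQ.
have n10 : 0 < (10 * n)%:R :> R by rewrite ltr0n muln_gt0.
rewrite -lee_pdivrMl//; apply: le_ereal_inf_tmp => _ [y Qy <-].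
have osc_le (C : cube R n) : Q `<=` C -> C `<=` P ->
    (local_oscillation s f C <= local_sharp s P f y)%E.
  by move=> QC CP; apply: ereal_sup_ubound; exists C => //; split => //; exact: QC.
have sharp0 : (0 <= local_sharp s P f y)%E.
  apply: le_trans (osc_le Q _ _) => //; first exact: local_oscillation_ge0.
  exact: dyadic_child_sub.
apply/lee_addgt0Pr => e e0.
case E : (local_sharp s P f y) sharp0 osc_le => [l| |] // l0 osc_le;
  last by rewrite leey.
rewrite lee_fin in l0; have le0 : 0 <= l + e by rewrite addr_ge0// ltW.
rewrite -EFinD -EFinM lee_fin ler_pdivrMl//.
apply: le_trans (_ : (8 * n)%:R * (l + e) <= _).
  apply: (median_child_le n0 s012 t1s mf muQ PQ0 PQ le0).
  move=> C QC CP.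
  have [|c [a [a0 al Ca]]] := @local_oscillation_lt _ _ s f C (l + e).
    by apply: le_lt_trans (osc_le _ QC CP) _; rewrite lte_fin ltrDl.
  exists c; apply: le_lt_trans Ca; apply: le_lebesgue_rV; apply: setIS.
  by apply: deviation_setS; rewrite subrr normr0 addr0 ltW.
by rewrite ler_wpM2r// ler_nat leq_mul2r orbT.
Qed.

End parent_median.

(** * Stopping cubes and their iteration *)

Section stopping_cubes.
Context {R : realType} {n : nat}.
Local Notation mu := (@lebesgue_rV R n).
Variables (f : 'rV[R]_n -> R) (s t : R).
Implicit Types (P Q S : cube R n).

Definition osc Q : R := fine (local_oscillation s f Q).

Definition exceptional_set S : set 'rV[R]_n :=
  deviation_set f (median f t S) (2 * osc S).

(** A proper dyadic subcube [Q] of [S] that is not dense has its median within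
    2 osc(S) of the median of [S]: 1 - t is the largest density for which
    [median_close] applies. *)
Definition dense_cubes S : set (cube R n) :=
  [set Q | [/\ dyadic S Q, Q <> S &
    ((1 - t)%:E * mu Q <= mu (Q `&` exceptional_set S))%E]].

Definition stopping_cubes S : set (cube R n) := maximal_cubes (dense_cubes S).

Fixpoint level S (v : nat) : set (cube R n) :=
  if v is v'.+1 then \bigcup_(P in level S v') stopping_cubes P else [set S].

Definition level_set S v : set 'rV[R]_n :=
  \bigcup_(Q in level S v) (Q : set 'rV[R]_n).

Lemma dense_cubes_dyadic S : dense_cubes S `<=` dyadic S.
Proof. by move=> Q []. Qed.

Lemma stopping_cubes_dyadic S Q : stopping_cubes S Q -> dyadic S Q.
Proof. by move=> [[]]. Qed.

Lemma level_dyadic S v Q : level S v Q -> dyadic S Q.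
Proof.
elim: v Q => [Q ->|v IH Q [P /IH SP /stopping_cubes_dyadic]].
  exact: dyadic_root.
exact: dyadic_trans.
Qed.

Lemma level_proper S v Q : level S v.+1 Q -> Q <> S.
Proof.
move=> [P /level_dyadic SP stopQ] QS; have [[PQ QP _] _] := stopQ.
by apply: QP; apply: dyadic_anti PQ; rewrite QS.
Qed.

Lemma levelSr S v : level S v.+1 = \bigcup_(P in stopping_cubes S) level P v.
Proof.
elim: v => [|v IH].
  apply/seteqP; split => [Q [_ -> SQ]|Q [P SP ->]]; first by exists Q.
  by exists S.
rewrite [LHS]/= -/(level S v.+1) IH.
apply/seteqP; split => [Q [P [P' SP' P'P] PQ]|Q [P' SP' [P P'P PQ]]].
  by exists P' => //; exists P.
by exists P => //; exists P'.
Qed.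

Lemma level_countable S v : countable (level S v).
Proof.
apply: sub_countable (subset_card_le _) (dyadic_countable S).
by move=> Q /level_dyadic.
Qed.

Lemma level_nonoverlapping S v Q Q' :
  level S v Q -> level S v Q' -> Q <> Q' -> nonoverlapping Q Q'.
Proof.
elim: v Q Q' => [Q Q' -> ->//|v IH Q Q' [P vP PQ] [P' vP' P'Q'] QQ'].
have [PP'|PP'] := pselect (P = P').
  rewrite -PP' in P'Q'.
  exact: (maximal_cubes_nonoverlapping (@dense_cubes_dyadic P)).
apply: nonoverlapping_sub (IH _ _ vP vP' PP'); apply: dyadic_sub;
  exact: stopping_cubes_dyadic.
Qed.

Lemma level_setS S v : level_set S v.+1 `<=` level_set S v.
Proof.
move=> x [Q [P vP PQ] Qx]; exists P => //.
exact: dyadic_sub (stopping_cubes_dyadic PQ) _ Qx.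
Qed.

Variable Q0 : cube R n.
Hypotheses (s012 : 0 < s < 1 / 2) (t1s : 1 / 2 <= t < 1 - s).
Hypothesis mf : lebesgue_measurable_fun Q0 f.
Hypothesis mu_gt0 : forall Q, (0 < mu Q)%E.

Let s0 : 0 < s. Proof. by case/andP: s012. Qed.
Let s12 : s < 1 / 2. Proof. by case/andP: s012. Qed.
Let t12 : 1 / 2 <= t. Proof. by case/andP: t1s. Qed.
Let ts : t < 1 - s. Proof. by case/andP: t1s. Qed.
Let one_sub_t_gt0 : 0 < 1 - t. Proof. by move: ts s0; lra. Qed.

Lemma osc_ge0 Q : 0 <= osc Q.
Proof. by rewrite fine_ge0// local_oscillation_ge0. Qed.

Lemma oscE Q : dyadic Q0 Q -> local_oscillation s f Q = (osc Q)%:E.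
Proof.
move=> /dyadic_sub QQ0; rewrite fineK//.
exact: local_oscillation_fin s0 (mu_gt0 Q) mf QQ0.
Qed.

Lemma lebesgue_exceptional_set S : dyadic Q0 S ->
  (mu (S `&` exceptional_set S) <= s%:E * mu S)%E.
Proof.
by move=> /dyadic_sub SQ0; exact: lebesgue_median_deviation mf SQ0.
Qed.

(** What is left of the exceptional set has density at most 1 - t < 1 in every
    dyadic subcube: it misses the dense ones, which lie in stopping cubes. *)
Lemma exceptional_set_stopped S : dyadic Q0 S ->
  mu ((S `&` exceptional_set S) `\`
      \bigcup_(Q in stopping_cubes S) (Q : set 'rV[R]_n)) = 0%E.
Proof.
move=> Q0S; set F := _ `\` _.
apply: (@lebesgue_sparse_null _ _ S F (1 - t)); first exact: ltW.
- by move=> x [[]].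
- move=> Q SQ; have [dQ|ndQ] := pselect (dense_cubes S Q).
    rewrite (_ : F `&` Q = set0).
      by rewrite lebesgue_rV0 mule_ge0// ?lebesgue_rV_ge0// lee_fin ltW.
    apply/seteqP; split => // x [[_ nx] Qx]; apply: nx.
    have [C stopC CQ] := maximal_cubes_cover (@dense_cubes_dyadic S) dQ.
    by exists C => //; exact: dyadic_sub CQ _ Qx.
  apply: (@le_trans _ _ (mu (Q `&` exceptional_set S))).
    by apply: le_lebesgue_rV => x [[[]]].
  have [->|QS] := pselect (Q = S).
    apply: le_trans (lebesgue_exceptional_set Q0S) _.
    by rewrite lee_wpmul2r ?lebesgue_rV_ge0// lee_fin; move: ts; lra.
  by rewrite leNgt; apply/negP => /ltW dQ; apply: ndQ.
- by move: t12; lra.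
Qed.

(** The stopping cubes are nonoverlapping and at least the fraction 1 - t of
    each is exceptional, while the exceptional set has measure at most s |S|.
    The sets [X Q] allow iterating the estimate over generations. *)
Lemma lebesgue_stopping_cubes S (X : cube R n -> set 'rV[R]_n) (c : R) :
  dyadic Q0 S -> 0 <= c ->
  (forall Q, stopping_cubes S Q -> (mu (X Q) <= c%:E * mu Q)%E) ->
  (mu (\bigcup_(Q in stopping_cubes S) X Q) <=
    (c * (s / (1 - t)))%:E * mu S)%E.
Proof.
move=> Q0S c0 Xc.
have ct0 : 0 <= c / (1 - t) by rewrite divr_ge0// ltW.
apply: (@le_trans _ _ ((c / (1 - t))%:E * mu (S `&` exceptional_set S))%E).
  apply: lebesgue_nonoverlapping_bigcup => //.
  - apply: sub_countable (subset_card_le _) (dyadic_countable S).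
    by move=> Q /stopping_cubes_dyadic.
  - by move=> Q Q'; exact: (maximal_cubes_nonoverlapping (@dense_cubes_dyadic S)).
  - move=> Q stopQ; apply: (le_trans (Xc _ stopQ)).
    rewrite EFinM -muleA lee_wpmul2l// lee_pdivlMl//.
    have [[SQ _ dQ] _] := stopQ; apply: (le_trans dQ); apply: le_lebesgue_rV.
    by move=> x [Qx ex]; split => //; split => //; exact: dyadic_sub SQ _ Qx.
rewrite (_ : c * (s / (1 - t)) = (c / (1 - t)) * s); last by ring.
rewrite [X in (_ <= X * _)%E]EFinM -muleA lee_wpmul2l//.
exact: lebesgue_exceptional_set.
Qed.

Lemma lebesgue_level_set S v : dyadic Q0 S ->
  (mu (level_set S v) <= ((s / (1 - t)) ^+ v)%:E * mu S)%E.
Proof.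
elim: v S => [|v IH] S Q0S.
  rewrite expr0 mul1e; apply: le_lebesgue_rV => x [_ ->]//.
have -> : level_set S v.+1 = \bigcup_(P in stopping_cubes S) level_set P v.
  rewrite /level_set levelSr; apply/seteqP.
  split => [x [Q [P SP PQ] Qx]|x [P SP [Q PQ Qx]]].
    by exists P => //; exists Q.
  by exists Q => //; exists P.
rewrite exprSr; apply: lebesgue_stopping_cubes => //.
  by rewrite exprn_ge0// divr_ge0// ltW.
by move=> Q /stopping_cubes_dyadic SQ; apply: IH; exact: dyadic_trans SQ.
Qed.

Lemma lebesgue_level_inter : mu (\bigcap_v level_set Q0 v) = 0%E.
Proof.
apply/eqP; rewrite eq_le outer_measure_ge0 andbT.
have le_v v : (mu (\bigcap_v level_set Q0 v) <=
    ((s / (1 - t)) ^+ v * fine (mu Q0))%:E)%E.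
  rewrite EFinM fineK ?lebesgue_cube_fin//.
  apply: le_trans (lebesgue_level_set v (dyadic_root Q0)).
  by apply: le_lebesgue_rV => x /(_ v I).
have theta0 : 0 <= s / (1 - t) by rewrite divr_ge0// ltW.
have theta1 : s / (1 - t) < 1 by rewrite ltr_pdivrMr// mul1r; move: ts; lra.
have cvg0 : ((s / (1 - t)) ^+ v * fine (mu Q0))%:E @[v --> \oo] -->
    (0 * fine (mu Q0))%:E.
  apply: cvg_EFin; first by apply: nearW.
  apply: cvgMl; apply: cvg_expr; by rewrite ger0_norm.
rewrite mul0r in cvg0; rewrite -[leRHS](cvg_lim _ cvg0)//; apply: lime_ge.
  by apply/cvg_ex; eexists; exact: cvg0.
exact: nearW.
Qed.

(** Inside [Q], the next generation consists of the stopping cubes of [Q], up to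
    the overlaps of [Q] with other cubes of its generation, which are null. *)
Lemma lebesgue_level_setI v Q : level Q0 v Q ->
  (mu (level_set Q0 v.+1 `&` Q) <= (s / (1 - t))%:E * mu Q)%E.
Proof.
move=> vQ; have Q0Q := level_dyadic vQ.
have U2 A B : (mu (A `|` B) <= mu A + mu B)%E := outer_measureU2 mu A B.
pose others := level Q0 v `\` [set Q].
apply: (@le_trans _ _ (mu (\bigcup_(C in stopping_cubes Q) C `|`
                           \bigcup_(P in others) (P `&` Q)))).
  apply: le_lebesgue_rV => x [[C [P vP PC] Cx] Qx].
  have [PQ|PQ] := pselect (P = Q); first by left; rewrite -PQ; exists C.
  right; exists P => //; split => //.
  exact: dyadic_sub (stopping_cubes_dyadic PC) _ Cx.
apply: (le_trans (U2 _ _)).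
rewrite [X in (_ + X)%E](_ : _ = 0%E) ?adde0; last first.
  apply/eqP; rewrite eq_le outer_measure_ge0 andbT.
  apply: le_trans (outer_measure_esum mu (fun P : cube R n => P `&` Q) _) _.
    apply: sub_countable (subset_card_le _) (level_countable Q0 v).
    by move=> P [].
  rewrite esum1// => P [vP PQ].
  exact/nonoverlapping_null/(level_nonoverlapping vP vQ PQ).
rewrite -[s / _]mul1r; apply: lebesgue_stopping_cubes => // C _.
by rewrite mul1e.
Qed.

(** The coefficients of the decomposition: the change of median from the parent
    of [Q] to [Q], plus what the next selection inside [Q] may cost. *)
Definition jump Q : R :=
  `|median f t Q - median f t (dyadic_parent Q0 Q)| + 2 * osc Q.

Lemma jump_ge0 Q : 0 <= jump Q.
Proof. by rewrite addr_ge0// mulr_ge0// osc_ge0. Qed.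

(** By maximality the parent of [Q] is not dense in [S], unless it is [S]
    itself, so its median is within 2 osc(S) of that of [S]. *)
Lemma stopping_cube_median S Q : dyadic Q0 S -> stopping_cubes S Q ->
  `|median f t Q - median f t S| + 2 * osc Q <= jump Q + 2 * osc S.
Proof.
move=> Q0S stopQ; have [[SQ QS _] _] := stopQ.
case: SQ QS stopQ => [//|P C SP PC _ stopC].
have Q0P := dyadic_trans Q0S SP.
rewrite /jump (dyadic_parentE Q0P PC).
rewrite addrAC lerD2r; apply: le_trans (ler_distD (median f t P) _ _) _.
rewrite lerD2l.
have [->|PS] := pselect (P = S).
  by rewrite subrr normr0 mulr_ge0// osc_ge0.
apply: (@median_close _ _ f t (1 - t)) => //; first by move: t12; lra.
rewrite ltNge; apply/negP => dP.
exact: maximal_cubes_parent stopC PC _.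
Qed.

Lemma level_median (A : nat -> \bar R) (x : 'rV[R]_n) :
  (forall v Q, level Q0 v.+1 Q -> cube_set Q x -> ((jump Q)%:E <= A v.+1)%E) ->
  forall v Q, level Q0 v Q -> cube_set Q x ->
  ((`|median f t Q - median f t Q0| + 2 * osc Q)%:E <=
    (2 * osc Q0)%:E + \sum_(1 <= i < v.+1) A i)%E.
Proof.
move=> jumpA; elim=> [Q -> Qx|v IH Q vQ Qx].
  by rewrite subrr normr0 add0r big_geq// adde0.
rewrite big_nat_recr//= addeA.
have [S vS stopQ] := vQ.
have Sx : cube_set S x by exact: dyadic_sub (stopping_cubes_dyadic stopQ) _ Qx.
apply: le_trans (leeD (IH _ vS Sx) (jumpA _ _ vQ Qx)).
rewrite -EFinD lee_fin.
apply: le_trans (lerD (ler_distD (median f t S) _ _) (lexx _)) _.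
rewrite addrAC -[leRHS]addrA [leRHS]addrC lerD2r [leRHS]addrC.
exact: stopping_cube_median (level_dyadic vS) stopQ.
Qed.

Lemma osc_le_sharp P Q x : dyadic Q0 Q -> Q `<=` P -> cube_set Q x ->
  ((osc Q)%:E <= local_sharp s P f x)%E.
Proof.
by move=> Q0Q QP Qx; rewrite -oscE//; apply: ereal_sup_ubound; exists Q.
Qed.

Lemma jump_le Q : (0 < n)%N -> dyadic Q0 Q -> Q <> Q0 ->
  ((jump Q)%:E <= (10 * n)%:R%:E *
      ereal_inf [set local_sharp s (dyadic_parent Q0 Q) f y | y in Q] +
    2%:E * ereal_inf [set local_sharp s Q f y | y in Q])%E.
Proof.
move=> n0 Q0Q QQ0; rewrite /jump EFinD; apply: leeD.
  case: Q0Q QQ0 => [//|P C Q0P PC _].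
  rewrite (dyadic_parentE Q0P PC).
  by apply: (median_parent_le n0 s012 t1s mf) => //; exact: dyadic_sub.
rewrite EFinM lee_wpmul2l ?lee_fin//.
by apply: le_ereal_inf_tmp => _ [y Qy <-]; exact: osc_le_sharp.
Qed.

End stopping_cubes.

Lemma local_sharpS (R : realType) n s (P Q : cube R n) f x : Q `<=` P ->
  (local_sharp s Q f x <= local_sharp s P f x)%E.
Proof.
move=> QP; apply: ge_ereal_sup => _ [C [Cx CQ] <-].
apply: ereal_sup_ubound; exists C => //; split => //.
exact: subset_trans QP.
Qed.

Lemma local_oscillation_null (R : realType) n s (Q : cube R n) f :
  lebesgue_rV Q = 0%E -> local_oscillation s f Q = +oo%E.
Proof.
move=> Q0; apply/eqP; rewrite -leye_eq.
apply: le_ereal_inf_tmp => _ [c _ <-]; apply: le_ereal_inf_tmp => _ [a [_ +] <-].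
by rewrite Q0 mule0 ltNge lebesgue_rV_ge0.
Qed.

Theorem theorem2p1 (R : realType) (n : nat) (hn : (0 < n)%N)
    (Q0 : cube R n) (f : 'rV[R]_n -> R)
    (mf : lebesgue_measurable_fun Q0 f)
    (s t : R) (hs : 0 < s < 1 / 2) (ht : 1 / 2 <= t < 1 - s) :
  exists (J I2 : nat -> set nat) (Q : nat -> nat -> cube R n)
    (a : nat -> nat -> R),
    let Omega v := \bigcup_(j in J v) (Q v j : set 'rV[R]_n) in
    [/\ (forall v, (1 <= v)%N -> I2 v `<=` J v),
        (forall v j, (1 <= v)%N -> J v j ->
          dyadic Q0 (Q v j) /\ Q v j <> Q0) &
        (forall v j, (1 <= v)%N -> J v j -> 0 <= a v j)] /\
    [/\ (* (i) *)
        lebesgue_ae (fun x => cube_set Q0 x ->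
          (`|f x - median f t Q0|%:E <=
             4%:E * local_sharp s Q0 f x +
             \sum_(1 <= v <oo) \esum_(j in I2 v)
               (a v j * \1_(Q v j) x)%:E)%E) /\
        (forall v j, (1 <= v)%N -> J v j ->
          let P := dyadic_parent Q0 (Q v j) in
          let mP := ereal_inf [set local_sharp s P f y | y in Q v j] in
          let mQ := ereal_inf [set local_sharp s (Q v j) f y | y in Q v j] in
          ((a v j)%:E <= (10 * n)%:R%:E * mP + 2%:E * mQ)%E /\
          ((10 * n)%:R%:E * mP + 2%:E * mQ <= (10 * n + 2)%:R%:E * mP)%E),
        (* (ii) *)
        (forall v j k, (1 <= v)%N -> J v j -> J v k -> j <> k ->
          nonoverlapping (Q v j) (Q v k)),
        (* (iii) *)
        (forall v, (1 <= v)%N -> Omega v.+1 `<=` Omega v) &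
        (* (iv) *)
        (forall v j, (1 <= v)%N -> J v j ->
          (lebesgue_rV (Omega v.+1 `&` Q v j) <=
             (s / (1 - t))%:E * lebesgue_rV (Q v j))%E)].
Proof.
(* If some cube is null, so is every cube, and the sharp maximal function is
   infinite. *)
have [[Q1 Q1_null]|mu_neq0] :=
    pselect (exists Q : cube R n, lebesgue_rV Q = 0%E).
  have sharp_oo x : cube_set Q0 x -> local_sharp s Q0 f x = +oo%E.
    move=> Q0x; apply/eqP; rewrite -leye_eq.
    rewrite -(@local_oscillation_null _ _ s Q0 f); last first.
      by rewrite (lebesgue_cube_scale Q0 Q1) Q1_null mule0.
    by apply: ereal_sup_ubound; exists Q0 => //; split.
  exists (fun=> set0), (fun=> set0), (fun _ _ => Q0), (fun _ _ => 0).
  split; first by split=> [v _ x []|v j _ []|v j _ []].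
  split; [|by move=> v j k _ []|by move=> v _ x [j []]|by move=> v j _ []].
  split; last by move=> v j _ [].
  exists set0; split; [exact: measurable0|exact: lebesgue_rV0|].
  move=> x /=; apply; move=> Q0x; rewrite sharp_oo// gt0_muley ?lte_fin//.
  rewrite addye ?leey//; apply/eqP => sumNy.
  have : (0 <= \sum_(1 <= v <oo) \esum_(j in (set0 : set nat))
      (0 * \1_Q0 x : R)%:E)%E.
    by apply: nneseries_ge0 => v _ _; rewrite esum_set0.
  by rewrite sumNy.
have mu_gt0 (Q : cube R n) : (0 < lebesgue_rV Q)%E.
  rewrite lt0e lebesgue_rV_ge0 andbT; apply/eqP => QE.
  by apply: mu_neq0; exists Q.
(* One numbering g serves all generations; g is injective, so distinct indices
   give distinct cubes. *)
have [D [g [gD g_inj gK]]] := countable_indexing (dyadic_countable Q0).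
pose J v := [set j | D j /\ level f s t Q0 v (g j)].
have JE v : \bigcup_(j in J v) (g j : set 'rV[R]_n) = level_set f s t Q0 v.
  apply/seteqP; split => [x [j [_ vj] jx]|x [Q vQ Qx]]; first by exists (g j).
  have [j Dj jQ] := gK _ (level_dyadic vQ).
  by exists j; rewrite /J/= jQ.
exists J, J, (fun _ => g), (fun _ j => jump f s t Q0 (g j)).
split.
  split=> [v _ j //|[//|v] j _ [_ vj]|v j _ _]; last exact: jump_ge0.
  by split; [exact: level_dyadic vj|exact: level_proper vj].
split; last first.
- by move=> v j v1 [_ vj]; rewrite JE; exact: lebesgue_level_setI.
- by move=> v _; rewrite !JE; exact: level_setS.
- move=> v j k _ [Dj vj] [Dk vk] jk; apply: level_nonoverlapping vj vk _.
  by move=> /g_inj; rewrite !inE => /(_ Dj Dk).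
split; last first.
  move=> [//|v] j _ [Dj vj] P mP mQ.
  have Q0g := level_dyadic vj; have gQ0 := level_proper vj.
  split; first exact: jump_le.
  have sharp_ge0 (C : cube R n) x : cube_set C x -> (0 <= local_sharp s C f x)%E.
    move=> Cx; apply: le_trans (local_oscillation_ge0 s f C) _.
    by apply: ereal_sup_ubound; exists C => //; split.
  have gP : g j `<=` P.
    rewrite /P; case: Q0g gQ0 => [//|P' C Q0P' P'C _].
    by rewrite (dyadic_parentE Q0P' P'C); exact: dyadic_child_sub.
  have mQP : (mQ <= mP)%E.
    apply: le_ereal_inf_tmp => _ [y gy <-].
    apply: le_trans (local_sharpS s f y gP).
    by apply: ereal_inf_lbound; exists y.
  have -> : ((10 * n + 2)%:R%:E * mP = (10 * n)%:R%:E * mP + 2%:E * mP)%E.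
    by rewrite natrD EFinD ge0_muleDl ?lee_fin.
  by apply: leeD => //; rewrite lee_wpmul2l ?lee_fin.
pose F (S : cube R n) := (S `&` exceptional_set f s t S) `\`
  \bigcup_(Q in stopping_cubes f s t S) (Q : set 'rV[R]_n).
pose N := \bigcup_(S in [set S | dyadic Q0 S]) (F S) `|`
  \bigcap_v level_set f s t Q0 v.
have N0 : lebesgue_rV N = 0%E.
  have U2 A B : (lebesgue_rV (A `|` B) <= lebesgue_rV A + lebesgue_rV B)%E :=
    outer_measureU2 (@lebesgue_rV R n) A B.
  apply/eqP; rewrite eq_le lebesgue_rV_ge0 andbT; apply: (le_trans (U2 _ _)).
  rewrite (lebesgue_level_inter hs ht mf mu_gt0) adde0.
  apply: le_trans (outer_measure_esum (@lebesgue_rV R n) F (dyadic_countable Q0)) _.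
  rewrite esum1// => S Q0S.
  exact: (exceptional_set_stopped hs ht mf mu_gt0 Q0S).
exists N; split => //.
  apply: (@le_caratheodory_measurable _ _ (@lebesgue_rV R n)) => X.
  have XN0 : lebesgue_rV (X `&` N) = 0%E.
    apply/eqP; rewrite eq_le lebesgue_rV_ge0 andbT -N0.
    by apply: le_lebesgue_rV => x [].
  rewrite [X in (X + _ <= _)%E]XN0 add0e.
  by apply: le_lebesgue_rV => x [].
move=> x /= nx; apply: contrapT => nN; apply: nx => Q0x.
have ex_out : exists v, `[< ~ level_set f s t Q0 v x >].
  apply: contrapT => /forallNP inO; apply: nN; right => v _.
  by apply: contrapT => nl; apply: (inO v); exact/asboolP.
(* Let v + 1 be the first generation that does not cover x, and S the cube of
   generation v containing x. *)
case: (ex_minnP ex_out) => -[/asboolP[]|v /asboolP nv minv].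
  by exists Q0.
have [S vS Sx] : level_set f s t Q0 v x.
  apply: contrapT => nv'; have : `[< ~ level_set f s t Q0 v x >] by apply/asboolP.
  by move=> /minv; rewrite ltnn.
have Q0S := level_dyadic vS.
have fS : `|f x - median f t S| <= 2 * osc f s S.
  rewrite leNgt; apply/negP => exc; apply: nN; left; exists S => //.
  split; first by split.
  by move=> [Q SQ Qx]; apply: nv; exists Q => //; exists S.
pose A v := \esum_(j in J v) (jump f s t Q0 (g j) * \1_(g j) x)%:E.
have A_ge0 i : (0 <= A i)%E.
  by apply: esum_ge0 => j _; rewrite lee_fin mulr_ge0// jump_ge0.
have jumpA i Q : level f s t Q0 i.+1 Q -> cube_set Q x ->
    ((jump f s t Q0 Q)%:E <= A i.+1)%E.
  move=> iQ Qx; have [j Dj jQ] := gK _ (level_dyadic iQ).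
  have <- : \esum_(j in [set j]) (jump f s t Q0 (g j) * \1_(g j) x)%:E =
      (jump f s t Q0 Q)%:E.
    rewrite esum_set1; rewrite jQ indicE mem_set// mulr1//.
    by rewrite lee_fin jump_ge0.
  apply: le_esum_set => [_ ->|k]; first by rewrite /J/= jQ.
  by rewrite lee_fin mulr_ge0// jump_ge0.
apply: (@le_trans _ _ ((2 * osc f s Q0)%:E + \sum_(1 <= i < v.+1) A i)%E).
  apply: le_trans (level_median ht mu_gt0 jumpA vS Sx).
  rewrite lee_fin.
  by have := ler_distD (median f t S) (f x) (median f t Q0); move: fS; lra.
apply: leeD; last by apply: nneseries_lim_ge => i _ _; exact: A_ge0.
have oscQ0 := osc_le_sharp hs mf mu_gt0 (dyadic_root Q0) (@subset_refl _ _) Q0x.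
apply: le_trans (_ : (4%:E * (osc f s Q0)%:E <= _)%E).
  by rewrite -EFinM lee_fin ler_wpM2r ?osc_ge0//; lra.
by rewrite lee_wpmul2l ?lee_fin.
Qed.
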